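(* Let $n\ge 1$, $b>0$, and let $a_1,\dots,a_n,f$ be bounded integrable scalar functions on $[0,b]$. Put $$A(x)=\begin{bmatrix}-a_1&-a_2&-a_3&\cdots&-a_n\\ 1&0&0&\cdots&0\\ 0&1&0&\cdots&0\\ \vdots&&\ddots&&\vdots\\ 0&0&\cdots&1&0\end{bmatrix},\qquad F(x)=\begin{bmatrix}f(x)\\0\\ \vdots\\0\end{bmatrix}$$ (for $n=1$, $A=[-a_1]$). The general solution on $[0,b]$ of the linear ODE $$\frac{d}{dx}U=A(x)U+F(x),\qquad U=\Big[\tfrac{d^{n-1}u}{dx^{n-1}},\tfrac{d^{n-2}u}{dx^{n-2}},\dots,u\Big]^T,$$ which is equivalent to $u^{(n)}+a_1(x)u^{(n-1)}+\cdots+a_n(x)u=f(x)$, is $$U(x)=\mathcal{E}[A](x)\, C+\mathcal{E}[A](x)\int_0^x \mathcal{F}[-A](s)\,F(s)\,ds ,$$ where $C$ is a constant $n\times 1$ matrix. That is, for every constant $C$ this formula gives a solution, and every solution is of this form for some constant $C$.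
   Context: Scalars are in a fixed field $\mathbb{K}=\mathbb{R}$ or $\mathbb{C}$. A matrix function is bounded and integrable on $[0,b]$ if all its entries are bounded and (Lebesgue) integrable on $[0,b]$. For a square matrix function $X$ on $[0,b]$ define the integral series $$\mathcal{E}[X](x)=I+\int_0^x X(t)\,dt+\int_0^x X(t)\int_0^t X(s)\,ds\,dt+\int_0^x X(t)\int_0^t X(s)\int_0^s X(\xi)\,d\xi\,ds\,dt+\cdots,$$ $$\mathcal{F}[X](x)=I+\int_0^x X(t)\,dt+\int_0^x\Big(\int_0^t X(s)\,ds\Big)X(t)\,dt+\int_0^x\Big(\int_0^t\Big(\int_0^s X(\xi)\,d\xi\Big) X(s)\,ds\Big)X(t)\,dt+\cdots,$$ i.e. $\mathcal{E}[X]=\sum_{k\ge0}E_k$ and $\mathcal{F}[X]=\sum_{k\ge0}F_k$ with $E_0=F_0=I$, $E_{k+1}(x)=\int_0^xX(t)E_k(t)\,dt$, $F_{k+1}(x)=\int_0^xF_k(t)X(t)\,dt$. A solution of a differential equation on an interval is an absolutely continuous function satisfying the equation for almost every $x$ in the interval. *)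

(* Defs.v *)
From HB Require Import structures.
From mathcomp Require Import all_boot all_order all_algebra.
From mathcomp Require Import all_classical all_reals all_analysis.
From mathcomp Require Import complex.

Set Implicit Arguments.
Unset Strict Implicit.
Unset Printing Implicit Defensive.
Import Order.TTheory GRing.Theory Num.Theory.
Import numFieldNormedType.Exports.

Local Open Scope classical_set_scope.
Local Open Scope ring_scope.
Local Open Scope complex_scope.

Inductive scalar_kind := RealScalars | ComplexScalars.

Definition scalar_field (R : realType) (k : scalar_kind) : numFieldType :=
  match k with
  | RealScalars => R
  | ComplexScalars => R[i]
  end.

Definition of_real (R : realType) (k : scalar_kind) : R -> scalar_field R k :=
  match k with
  | RealScalars => fun r => r
  | ComplexScalars => fun r => r%:C
  end.

(* The completed measure is used because [lebesgue_measure] lives on the Borel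
   sets only, so that integrability for it would mean Borel measurability. *)
Notation leb R := (@completed_lebesgue_measure R).

Definition scalar_integrable (R : realType) (k : scalar_kind) (D : set R) :
    (R -> scalar_field R k) -> Prop :=
  match k with
  | RealScalars => fun f => (leb R).-integrable D (EFin \o f)
  | ComplexScalars => fun f =>
      (leb R).-integrable D (fun t => (complex.Re (f t))%:E) /\
      (leb R).-integrable D (fun t => (complex.Im (f t))%:E)
  end.

Definition scalar_integral (R : realType) (k : scalar_kind) (D : set R) :
    (R -> scalar_field R k) -> scalar_field R k :=
  match k with
  | RealScalars => fun f => \int[leb R]_(t in D) f t
  | ComplexScalars => fun f =>
      (\int[leb R]_(t in D) complex.Re (f t)) +i*
      (\int[leb R]_(t in D) complex.Im (f t))
  end.

Section ode.
Variables (R : realType) (k : scalar_kind).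
Local Notation K := (scalar_field R k).

Definition bounded_integrable (b : R) (f : R -> K) : Prop :=
  [bounded f x | x in `[0, b]] /\ scalar_integrable `[0, b] f.

Definition mx_integral (m n : nat) (x : R) (M : R -> 'M[K]_(m, n)) :
    'M[K]_(m, n) :=
  \matrix_(i, j) scalar_integral `[0, x] (fun t => M t i j).

Fixpoint Eterm (n : nat) (X : R -> 'M[K]_n) (p : nat) : R -> 'M[K]_n :=
  if p is q.+1 then fun x => mx_integral x (fun t => X t *m Eterm X q t)
  else fun=> 1%:M.

Fixpoint Fterm (n : nat) (X : R -> 'M[K]_n) (p : nat) : R -> 'M[K]_n :=
  if p is q.+1 then fun x => mx_integral x (fun t => Fterm X q t *m X t)
  else fun=> 1%:M.

Definition Eseries (n : nat) (X : R -> 'M[K]_n) (x : R) : 'M[K]_n :=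
  \matrix_(i, j) limn (series (fun p => Eterm X p x i j)).

Definition Fseries (n : nat) (X : R -> 'M[K]_n) (x : R) : 'M[K]_n :=
  \matrix_(i, j) limn (series (fun p => Fterm X p x i j)).

(* [u] has derivative [v] at [x] relative to [0, b], hence one-sided at the
   endpoints; nothing depends on the values of [u] outside [0, b]. *)
Definition has_derivative (b : R) (u : R -> K) (x : R) (v : K) : Prop :=
  of_real k (y - x)^-1 * (u y - u x) @[y --> within `[0, b] x^'] --> v.

(* [v] is the [p]-th derivative of [u] at every point of [0, b]. *)
Fixpoint nth_derivative (b : R) (p : nat) (u v : R -> K) : Prop :=
  if p is q.+1 then
    exists w, nth_derivative b q u w /\
              forall x, x \in `[0, b] -> has_derivative b w x (v x)
  else forall x, x \in `[0, b] -> v x = u x.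

Definition absolutely_continuous (b : R) (u : R -> K) : Prop :=
  forall eps : R, 0 < eps -> exists2 delta : R, 0 < delta &
    forall (m : nat) (x y : 'I_m -> R),
      (forall i, 0 <= x i /\ x i < y i /\ y i <= b) ->
      (forall i j, i != j -> `]x i, y i[ `&` `]x j, y j[ = set0) ->
      \sum_i (y i - x i) < delta ->
      \sum_i `|u (y i) - u (x i)| < of_real k eps.

Definition system_solution (n : nat) (b : R) (A : R -> 'M[K]_n)
    (F : R -> 'cV[K]_n) (U : R -> 'cV[K]_n) : Prop :=
  (forall i, absolutely_continuous b (fun x => U x i ord0)) /\
  {ae leb R, forall x, x \in `[0, b] ->
    forall i, has_derivative b (fun y => U y i ord0) x
                ((A x *m U x + F x) i ord0)}.

(* Indices are shifted: [a j] is the coefficient a_{j+1}. *)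
Definition companion (n : nat) (a : 'I_n -> R -> K) (x : R) : 'M[K]_n :=
  \matrix_(i, j) if i == 0 :> nat then - a j x else (i == j.+1 :> nat)%:R.

Definition forcing (n : nat) (f : R -> K) (x : R) : 'cV[K]_n :=
  \col_i if i == 0 :> nat then f x else 0.

(* U = [u^(n-1), ..., u', u]^T on [0, b] *)
Definition derivative_vector (n : nat) (b : R) (u : R -> K)
    (U : R -> 'cV[K]_n) : Prop :=
  forall i : 'I_n, nth_derivative b (n.-1 - i) u (fun x => U x i ord0).

(* u^(n) + a_1 u^(n-1) + ... + a_n u = f almost everywhere on [0, b], where
   u, ..., u^(n-1) exist everywhere, u^(n-1) is absolutely continuous and u^(n)
   is its derivative almost everywhere; [d p] stands for u^(p). *)
Definition scalar_solution (n : nat) (b : R) (a : 'I_n -> R -> K)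
    (f u : R -> K) : Prop :=
  exists d : nat -> R -> K,
    [/\ forall p, (p < n)%N -> nth_derivative b p u (d p),
        absolutely_continuous b (d n.-1) &
        {ae leb R, forall x, x \in `[0, b] ->
          exists2 v, has_derivative b (d n.-1) x v &
            v + \sum_(j < n) a j x * d (n.-1 - j)%N x = f x}].

Definition general_solution (n : nat) (A : R -> 'M[K]_n) (F : R -> 'cV[K]_n)
    (C : 'cV[K]_n) (x : R) : 'cV[K]_n :=
  Eseries A x *m C +
  Eseries A x *m
    mx_integral x (fun s => Fseries (fun t => - A t) s *m F s).

End ode.

(* Main.v *)
Require Import Defs.
From mathcomp Require Import all_boot all_order all_algebra.
From mathcomp Require Import all_classical all_reals all_analysis.
From mathcomp Require Import measurable_realfun complex ring lra.

Set Implicit Arguments.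
Unset Strict Implicit.
Unset Printing Implicit Defensive.
Import Order.TTheory GRing.Theory Num.Theory.
Import numFieldNormedType.Exports.

Local Open Scope classical_set_scope.
Local Open Scope ring_scope.

(** Everything rests on one relation: U is a primitive of V on [0, b] when the
    entries of U are absolutely continuous and U' = V almost everywhere.

    Primitives are unique up to a constant.  This follows from a mean value
    inequality ([mean_value_ineq]): if u is absolutely continuous, phi is
    nondecreasing and |u'| <= phi' almost everywhere, then
    |u t - u s| <= phi t - phi s.  Its proof covers the exceptional null set by
    an open set G of measure so small that absolute continuity bounds the
    variation of u along the intervals contained in G; the remaining points
    have a neighbourhood on which the inequality holds up to a small slope, and
    the compactness of [s, t] glues these local estimates.  Primitives exist:
    for bounded integrable g the function x |-> int_0^x g is a primitive of g
    ([scalar_integral_primitive]); by passing to a Borel representative this is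
    the Lebesgue differentiation theorem.  Finally primitives obey the Leibniz
    rule ([primitiveM]).

    The terms of E[A] satisfy E_(p+1)' = A E_p, so the mean value inequality
    with phi x = (L x)^(p+1) / (p+1)! bounds them by the terms of an exponential
    series.  The series therefore converges uniformly, may be integrated term by
    term, and E[A] is the primitive of A E[A] with value 1 at 0
    ([Eseries_primitive]).  Since F[X] is the transpose of E[X^T],
    F[-A] is the primitive of - F[-A] A with value 1 at 0.

    Hence (F[-A] E[A])' = - F[-A] A E[A] + F[-A] A E[A] = 0, so that
    F[-A] E[A] = 1 on [0, b], and E[A] F[-A] = 1 as the matrices are square.
    Variation of constants concludes: U' = A U + F if and only if
    (F[-A] U)' = F[-A] F, that is, if and only if
    U = E[A] (C + int_0^x F[-A] F) with C = U 0.

    For the equivalence with the scalar equation, the rows of the system below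
    the first one say that an entry is almost everywhere the derivative of the
    next one.  As the entries are continuous, this upgrades to a derivative at
    every point ([ae_derivative_everywhere]), so the entries are the successive
    derivatives of the last one; conversely a function with a bounded derivative
    everywhere is Lipschitz, hence absolutely continuous. *)

(** * Real and complex scalars *)

Section scalars.
Variables (R : realType) (k : scalar_kind).
Local Notation K := (scalar_field R k).

(** For real scalars the imaginary part is 0, so that computing by coordinates
    treats both fields at once. *)
Definition rpart : K -> R :=
  match k with RealScalars => fun z => z | ComplexScalars => @complex.Re R end.

Definition ipart : K -> R :=
  match k with RealScalars => fun=> 0 | ComplexScalars => @complex.Im R end.

(** The norm of K has its values in K; this real version is compared in the
    total order of R. *)
Definition modulus (z : K) : R := rpart `|z|.

Lemma of_realD (x y : R) : of_real k (x + y) = of_real k x + of_real k y.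
Proof. by case: k => //=; rewrite rmorphD. Qed.

Lemma of_realM (x y : R) : of_real k (x * y) = of_real k x * of_real k y.
Proof. by case: k => //=; rewrite rmorphM. Qed.

Lemma of_real0 : of_real k (0 : R) = 0.
Proof. by case: k. Qed.

Lemma of_real1 : of_real k (1 : R) = 1.
Proof. by case: k. Qed.

Lemma of_realN (x : R) : of_real k (- x) = - of_real k x.
Proof. by apply: (addrI (of_real k x)); rewrite -of_realD !subrr of_real0. Qed.

Lemma of_realB (x y : R) : of_real k (x - y) = of_real k x - of_real k y.
Proof. by rewrite of_realD of_realN. Qed.

Lemma of_realV (x : R) : of_real k x^-1 = (of_real k x)^-1.
Proof. by case: k => //=; rewrite fmorphV. Qed.

Lemma of_real_sum I (r : seq I) (P : pred I) (F : I -> R) :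
  of_real k (\sum_(i <- r | P i) F i) = \sum_(i <- r | P i) of_real k (F i).
Proof. exact: (big_morph _ of_realD of_real0). Qed.

Lemma ler_of_real (x y : R) : (of_real k x <= of_real k y) = (x <= y).
Proof. by case: k => //=; rewrite lecR. Qed.

Lemma ltr_of_real (x y : R) : (of_real k x < of_real k y) = (x < y).
Proof. by case: k => //=; rewrite ltcR. Qed.

Lemma rpart_of_real (x : R) : rpart (of_real k x) = x.
Proof. by rewrite /rpart /of_real; case: k. Qed.

Lemma ipart_of_real (x : R) : ipart (of_real k x) = 0.
Proof. by rewrite /ipart /of_real; case: k. Qed.

Lemma of_real_pos (e : K) : 0 < e -> exists2 r : R, 0 < r & e = of_real k r.
Proof.
rewrite /of_real; move: e; case: k => /= e e0; first by exists e.
case: e e0 => x y; rewrite ltcE /= => /andP[/eqP -> x0].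
by exists x.
Qed.

Lemma norm_modulus (z : K) : `|z| = of_real k (modulus z).
Proof.
have : 0 <= `|z| by [].
rewrite /modulus; move: (`|z|); rewrite /rpart /of_real; case: k => //= -[x y].
by rewrite lecE /= => /andP[/eqP -> _].
Qed.

Lemma modulus_ge0 (z : K) : 0 <= modulus z.
Proof. by rewrite -ler_of_real of_real0 -norm_modulus. Qed.

Lemma modulusD (z w : K) : modulus (z + w) <= modulus z + modulus w.
Proof. by rewrite -ler_of_real of_realD -!norm_modulus ler_normD. Qed.

Lemma modulusM (z w : K) : modulus (z * w) = modulus z * modulus w.
Proof. 
by rewrite /modulus normrM !norm_modulus -of_realM !rpart_of_real.
Qed.

Lemma modulusN (z : K) : modulus (- z) = modulus z.
Proof. by rewrite /modulus normrN. Qed.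

Lemma modulusBC (z w : K) : modulus (z - w) = modulus (w - z).
Proof. by rewrite -modulusN opprB. Qed.

Lemma modulusB (z w : K) : modulus (z - w) <= modulus z + modulus w.
Proof. by rewrite -(modulusN w) modulusD. Qed.

Lemma modulus_of_real (x : R) : modulus (of_real k x) = `|x|.
Proof.
rewrite /modulus; have [x0|x0] := leP 0 x.
  have -> : `|of_real k x| = of_real k x.
    by apply: ger0_norm; rewrite -of_real0 ler_of_real.
  by rewrite rpart_of_real ger0_norm.
have -> : `|of_real k x| = of_real k (- x).
  by rewrite of_realN; apply: ltr0_norm; rewrite -of_real0 ltr_of_real.
by rewrite rpart_of_real ltr0_norm.
Qed.

Lemma modulus0 : modulus (0 : K) = 0.
Proof. by rewrite -of_real0 modulus_of_real normr0. Qed.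

Lemma modulus1 : modulus (1 : K) = 1.
Proof. by rewrite -of_real1 modulus_of_real normr1. Qed.

Lemma modulus_le0 (z : K) : modulus z <= 0 -> z = 0.
Proof.
move=> z0; apply/eqP; rewrite -normr_eq0 norm_modulus.
by rewrite (_ : modulus z = 0) ?of_real0//; apply/le_anti; rewrite z0 modulus_ge0.
Qed.

Lemma modulus_sum I (r : seq I) (P : pred I) (F : I -> K) :
  modulus (\sum_(i <- r | P i) F i) <= \sum_(i <- r | P i) modulus (F i).
Proof.
rewrite -ler_of_real of_real_sum -norm_modulus.
apply: le_trans (ler_norm_sum _ _ _) _.
by apply: ler_sum => i _; rewrite norm_modulus.
Qed.

Lemma rpartD (z w : K) : rpart (z + w) = rpart z + rpart w.
Proof. by move: z w; rewrite /rpart; case: k => //= -[? ?] [? ?]. Qed.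

Lemma ipartD (z w : K) : ipart (z + w) = ipart z + ipart w.
Proof. by move: z w; rewrite /ipart; case: k => //= [_ _|[? ?] [? ?]//]; rewrite addr0. Qed.

Lemma rpartM (z w : K) :
  rpart (z * w) = rpart z * rpart w - ipart z * ipart w.
Proof.
by move: z w; rewrite /rpart /ipart; case: k => //= [z w|[? ?] [? ?]//]; rewrite mulr0 subr0.
Qed.

Lemma ipartM (z w : K) :
  ipart (z * w) = rpart z * ipart w + ipart z * rpart w.
Proof.
move: z w; rewrite /rpart /ipart; case: k => //= [z w|[? ?] [? ?]//].
by rewrite mulr0 mul0r addr0.
Qed.

Lemma rpartN (z : K) : rpart (- z) = - rpart z.
Proof. by move: z; rewrite /rpart; case: k => //= -[? ?]. Qed.

Lemma ipartN (z : K) : ipart (- z) = - ipart z.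
Proof. by move: z; rewrite /ipart; case: k => //= [_|[? ?]//]; rewrite oppr0. Qed.

Lemma ler_rpart (z : K) : `|rpart z| <= modulus z.
Proof.
rewrite /modulus; move: z; rewrite /rpart; case: k => //= -[x y] /=.
by rewrite -sqrtr_sqr ler_wsqrtr// lerDl sqr_ge0.
Qed.

Lemma ler_ipart (z : K) : `|ipart z| <= modulus z.
Proof.
rewrite /modulus; move: z; rewrite /rpart /ipart; case: k => //= [z|[x y]] /=.
  by rewrite normr0.
by rewrite -sqrtr_sqr ler_wsqrtr// lerDr sqr_ge0.
Qed.

Lemma ler_modulus (z : K) : modulus z <= `|rpart z| + `|ipart z|.
Proof.
rewrite /modulus; move: z; rewrite /rpart /ipart; case: k => //= [z|[x y]] /=.
  by rewrite normr0 addr0.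
rewrite -(@ler_pXn2r _ 2)// ?nnegrE ?sqrtr_ge0 ?addr_ge0//.
rewrite sqr_sqrtr ?addr_ge0 ?sqr_ge0// sqrrD !real_normK ?num_real//.
by rewrite lerD2r lerDl mulrn_wge0// mulr_ge0.
Qed.

Lemma cvg_modulusP T (F : set_system T) {FF : Filter F} (f : T -> K) (l : K) :
  f @ F --> l <->
  forall e : R, 0 < e -> \forall y \near F, modulus (l - f y) < e.
Proof.
split=> [/cvgrPdist_lt H e e0|H].
  have e0' : 0 < of_real k e by rewrite -of_real0 ltr_of_real.
  have := H _ e0'; apply: filterS => y.
  by rewrite norm_modulus ltr_of_real.
apply/cvgrPdist_lt => e /of_real_pos[r r0 ->].
by have := H _ r0; apply: filterS => y; rewrite norm_modulus ltr_of_real.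
Qed.

Lemma cvg_seq_modulusP (u : nat -> K) (l : K) : u @ \oo --> l <->
  forall e : R, 0 < e -> exists N, forall n, (N <= n)%N -> modulus (l - u n) < e.
Proof.
split=> [/cvg_modulusP H e /H[N _ HN]|H].
  by exists N => n Nn; apply: HN.
by apply/cvg_modulusP => e /H[N HN]; exists N.
Qed.

(** Without the quotient the estimate also covers y = x, and the estimates on
    both sides of x add up to one over an interval around x. *)
Lemma has_derivativeP (b : R) (u : R -> K) (x : R) (v : K) :
  has_derivative b u x v <-> forall e : R, 0 < e -> exists2 d : R, 0 < d &
    forall y, 0 <= y -> y <= b -> `|y - x| < d ->
      modulus (u y - u x - of_real k (y - x) * v) <= e * `|y - x|.
Proof.
have key y : y != x ->
    modulus (u y - u x - of_real k (y - x) * v) =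
    modulus (v - of_real k (y - x)^-1 * (u y - u x)) * `|y - x|.
  move=> yx; rewrite -(modulus_of_real (y - x)) -modulusM modulusBC [in RHS]mulrC.
  have yx0 : of_real k (y - x) != 0.
    apply: contra yx => /eqP/(congr1 rpart).
    by rewrite -of_real0 !rpart_of_real => /eqP; rewrite subr_eq0.
  by rewrite of_realV mulrBr mulVKf.
rewrite /has_derivative; split=> [/cvg_modulusP H e /H|H].
  rewrite near_withinE => /nbhs_ballP[d /= d0 Hd].
  exists d => // y y0 yb yd.
  have [->|yx] := eqVneq y x.
    by rewrite !subrr of_real0 mul0r subr0 modulus0 normr0 mulr0.
  rewrite key// ler_wpM2r// ltW//; apply: Hd => //.
    by rewrite /ball /= distrC.
  by rewrite in_itv /= y0.
apply/cvg_modulusP => e e0; have [d d0 Hd] := H _ (divr_gt0 e0 (ltr0Sn R 1)).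
rewrite near_withinE; apply/nbhs_ballP; exists d => //= y yd yx.
rewrite in_itv /= => /andP[y0 yb].
have yx0 : 0 < `|y - x| by rewrite normr_gt0 subr_eq0.
have : modulus (u y - u x - of_real k (y - x) * v) <= e / 2 * `|y - x|.
  by apply: Hd => //; rewrite distrC.
rewrite key// ler_pM2r// => /le_lt_trans; apply.
by rewrite ltr_pdivrMr// ltr_pMr// ltr1n.
Qed.

Lemma absolutely_continuousP (b : R) (u : R -> K) :
  absolutely_continuous b u <->
  forall eps : R, 0 < eps -> exists2 delta : R, 0 < delta &
    forall (m : nat) (x y : 'I_m -> R),
      (forall i, 0 <= x i /\ x i < y i /\ y i <= b) ->
      (forall i j, i != j -> `]x i, y i[ `&` `]x j, y j[ = set0) ->
      \sum_i (y i - x i) < delta ->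
      \sum_i modulus (u (y i) - u (x i)) < eps.
Proof.
split=> H e /H[d d0 Hd]; exists d => // m x y xy dis dl; have := Hd m x y xy dis dl.
  by under eq_bigr do rewrite norm_modulus; rewrite -of_real_sum ltr_of_real.
by under [in X in _ -> X]eq_bigr do rewrite norm_modulus; rewrite -of_real_sum ltr_of_real.
Qed.

End scalars.

(** * The completed Lebesgue measure *)

Notation lebesgueType R := (caratheodory_type (@wlength R idfun)^*%mu).

Section completed_measure.
Variable R : realType.
Local Notation mu := (@lebesgue_measure R).

(** Both measures restrict the same outer measure, and a set of outer measure 0
    lies in a Borel null set. *)
Lemma negligible_completed (N : set R) :
  (leb R).-negligible N -> mu.-negligible N.
Proof.
move=> [A [mA A0 NA]]; apply/negligible_outer_measure.
apply/eqP; rewrite eq_le outer_measure_ge0 andbT.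
apply: le_trans (_ : leb R A <= 0)%E; first exact: le_outer_measure.
by rewrite A0.
Qed.

Lemma ae_completed (P : R -> Prop) :
  {ae mu, forall x, P x} -> {ae leb R, forall x, P x}.
Proof.
by move=> [A [mA A0 NA]]; exists A; split => //; exact: sub_caratheodory.
Qed.

#[global] Instance filter_ae_completed : Filter (nbhs (almost_everywhere (leb R))).
Proof. exact: ae_filter_ringOfSetsType. Qed.

(** Outer regularity, applied to the exceptional set. *)
Lemma ae_open_cover (P : R -> Prop) (d : R) : {ae leb R, forall x, P x} ->
  0 < d -> exists O : set R,
    [/\ open O, (mu O < d%:E)%E & forall x, ~ O x -> P x].
Proof.
move=> /negligible_completed/negligible_outer_measure N0 d0.
have d20 : 0 < d / 2 by rewrite divr_gt0.
have [G [oG NG muG]] := outer_measure_open_le (~` P) d20.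
exists G; split => //.
  apply: le_lt_trans muG _; rewrite N0 add0e lte_fin.
  by rewrite ltr_pdivrMr// ltr_pMr// ltr1n.
by move=> x Gx; apply: contrapT => nPx; apply/Gx/NG.
Qed.

Let measurable_id_completed :
  @measurable_fun _ _ (lebesgueType R) (measurableTypeR R) setT
    (id : lebesgueType R -> measurableTypeR R).
Proof. by move=> _ Y mY; rewrite setTI; exact: sub_caratheodory. Qed.

(** For each rational q the set where q < g is the union of a Borel set and of a
    subset of a Borel null set.  Setting g to 0 on the union of these countably
    many null sets makes all its level sets Borel. *)
Lemma borel_representative (g : R -> R) :
  @measurable_fun _ _ (lebesgueType R) (measurableTypeR R) setT g ->
  exists2 h : R -> R, @measurable_fun _ _ (measurableTypeR R) _ setT h &
    {ae leb R, forall x, g x = h x}.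
Proof.
move=> mg.
(* [r] enumerates the rationals. *)
pose r (n : nat) : R := ratr (odflt 0%Q (unpickle n)).
have dense_r (x y : R) : x < y -> exists n, x < r n /\ r n < y.
  move=> /rat_in_itvoo[q]; rewrite in_itv /= => /andP[xq qy].
  by exists (pickle q); rewrite /r pickleK.
have /choice[B HB] : forall n, exists B : set R * set R,
    [/\ @measurable _ (measurableTypeR R) B.1, mu.-negligible B.2 &
    [set x | r n < g x] = B.1 `|` B.2].
  move=> n.
  have mgr : @measurable _ (lebesgueType R) (g @^-1` `]r n, +oo[).
    by rewrite -[X in measurable X]setTI; apply: mg.
  have : completed_algebra_gen mu (g @^-1` `]r n, +oo[).
    rewrite -g_sigma_completed_algebra_genE completed_caratheodory_measurable.
    exact: mgr.
  move=> [B1 mB1 [B2 B20 BE]].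
  exists (B1, B2); split => //=; rewrite BE.
  by apply/seteqP; split => x /=; rewrite in_itv /= andbT.
have : mu.-negligible (\bigcup_n (B n).2).
  by apply: negligible_bigcup => n; have [] := HB n.
move=> [N [mN N0 BN]].
pose h x := if x \in N then 0 else g x.
exists h; last first.
  exists N; split; [exact: sub_caratheodory|exact: N0|].
  by move=> x /=; apply: contra_notP => Nx; rewrite /h memNset.
have hE n : h @^-1` `]r n, +oo[ =
    ((B n).1 `\` N) `|` (if r n < 0 then N else set0).
  have [_ _ Bn] := HB n.
  apply/seteqP; split => x /=; rewrite in_itv /= andbT /h.
    case: (boolP (x \in N)) => xN; first by move=> ->; right; rewrite -inE.
    rewrite notin_setE in xN => rg; left; split => //.
    have : [set x | r n < g x] x by [].
    by rewrite Bn => -[//|B2]; exfalso; apply: xN; apply: BN; exists n.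
  move=> [[B1 xN]|]; last by case: ifP => // rn0 xN; rewrite mem_set.
  rewrite memNset//; suff : [set x | r n < g x] x by [].
  by rewrite Bn; left.
move=> _; apply: (measurability _ (RGenOInfty.measurableE R)) => //.
move=> _ [_ [a ->] <-]; rewrite setTI.
have -> : h @^-1` `]a, +oo[ = \bigcup_(n in [set n | a < r n]) (h @^-1` `]r n, +oo[).
  apply/seteqP; split => x /=; rewrite in_itv /= andbT.
    by move=> /dense_r[n [an nh]]; exists n => //=; rewrite in_itv /= nh.
  by move=> [n /= an]; rewrite in_itv /= andbT; exact: lt_trans.
apply: bigcup_measurable => n _; rewrite hE; have [mB _ _] := HB n.
apply: measurableU; first exact: measurableD.
by case: ifP.
Qed.

(** The Borel measure is the image of the completed one under the identity map,
    which is measurable from the completed sigma-algebra to the Borel one. *)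
Lemma integral_completed (h : R -> R) (a c : R) :
  @measurable_fun _ _ (measurableTypeR R) _ setT h ->
  (leb R).-integrable `[a, c] (EFin \o h) ->
  mu.-integrable `[a, c] (EFin \o h) /\
  \int[mu]_(t in `[a, c]) h t = \int[leb R]_(t in `[a, c]) h t.
Proof.
move=> mh ih.
have mh' : measurable_fun setT (EFin \o h) by apply/measurable_EFinP.
have muE (A : set R) : @measurable _ (measurableTypeR R) A ->
    mu A = pushforward (leb R) (id : _ -> measurableTypeR R) A.
  by [].
have mD : @measurable _ (measurableTypeR R) `[a, c] by [].
have i1 := integrable_pushforward measurable_id_completed mh' ih mD.
have e1 := integral_pushforward measurable_id_completed mh' ih mD.
split; first exact: i1.
by rewrite /Rintegral; congr fine; exact: e1.
Qed.

End completed_measure.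

(** * Indefinite integrals of real functions *)

Section real_integral.
Variable R : realType.
Local Notation mu := (@lebesgue_measure R).

Lemma derivable_eps (f : R -> R) (x v : R) : derivable f x 1 -> f^`()%classic x = v ->
  forall e : R, 0 < e -> exists2 d : R, 0 < d &
    forall y, `|y - x| < d -> `|f y - f x - (y - x) * v| <= e * `|y - x|.
Proof.
move=> df; rewrite derive1E => dv e e0.
have : h^-1 *: (f (h *: 1 + x) - f x) @[h --> 0^'] --> v by rewrite -dv.
move/cvgrPdist_le => /(_ e e0) /nbhs_ballP[d /= d0 Hd].
exists d => // y yd.
have [->|yx] := eqVneq y x; first by rewrite !subrr mul0r subr0 normr0 mulr0.
have yx0 : y - x != 0 by rewrite subr_eq0.
have := Hd (y - x); rewrite /ball /= sub0r normrN => /(_ yd yx0).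
rewrite /GRing.scale /= mulr1 subrK => H.
have -> : f y - f x - (y - x) * v = - ((v - (y - x)^-1 * (f y - f x)) * (y - x)).
  by field.
by rewrite normrN normrM ler_wpM2r.
Qed.

(** A Borel representative of g, truncated to [-M, M] and extended by 0 outside
    [0, b], has the same integrals and is locally integrable, so Lebesgue's
    differentiation theorem applies to it. *)
Lemma real_integral_primitive (b M : R) (g : R -> R) : 0 < b ->
  (leb R).-integrable `[0, b] (EFin \o g) ->
  (forall x, 0 <= x -> x <= b -> `|g x| <= M) ->
  let G x := \int[leb R]_(t in `[0, x]) g t in
  [/\ G 0 = 0,
      forall s t, 0 <= s -> s <= t -> t <= b -> `|G t - G s| <= M * (t - s) &
      {ae leb R, forall x, x \in `[0, b] ->
        @has_derivative R RealScalars b G x (g x)}].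
Proof.
move=> b0 ig gM G.
have M0 : 0 <= M by apply: le_trans (gM 0 (lexx 0) (ltW b0)).
have mc (D : set R) : @measurable _ (measurableTypeR R) D ->
  @measurable _ (lebesgueType R) D.
  by move=> mD; exact: sub_caratheodory.
have mid : @measurable_fun _ _ (lebesgueType R)
    (measurableTypeR R) setT id.
  by move=> _ Y mY; rewrite setTI; exact: sub_caratheodory.
have mg : @measurable_fun _ _ (lebesgueType R) (measurableTypeR R) `[0, b] g.
  by apply/measurable_EFinP; exact: measurable_int ig.
have mg0 : @measurable_fun _ _ (lebesgueType R) (measurableTypeR R) setT
    (g \_ `[0, b]).
  by apply/(measurable_restrictT _ _).1 => //; exact: mc.
have [h mh gh] := borel_representative mg0.
pose h1 : R -> R := (fun x => Num.max (- M) (Num.min M (h x))) \_ `[0, b].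
have h1M x : `|h1 x| <= M.
  rewrite /h1 patchE; case: ifP => _; last by rewrite normr0.
  rewrite ler_norml le_max lexx /= ge_max ge_min lexx /= andbT.
  by rewrite (le_trans _ M0)// oppr_le0.
have mh1 : @measurable_fun _ _ (measurableTypeR R) _ setT h1.
  apply/(measurable_restrictT _ _).1 => //; apply: measurable_funTS.
  apply: measurable_maxr; first exact: measurable_cst.
  by apply: measurable_minr => //; exact: measurable_cst.
have mh1c : @measurable_fun _ _ (lebesgueType R) _ setT h1.
  exact: (measurableT_comp mh1 mid).
have gh1 : {ae leb R, forall x, x \in `[0, b] -> g x = h1 x}.
  apply: filterS gh => x gx xb; move: (xb); rewrite in_itv /= => /andP[x0 xb'].
  have := gM x x0 xb'; move: gx; rewrite /h1 !patchE mem_set// => <-.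
  by rewrite ler_norml => /andP[Mg gM']; rewrite (min_idPr gM') (max_idPr Mg).
have ih1 a c : (leb R).-integrable `[a, c] (EFin \o h1).
  apply: measurable_bounded_integrable => //; first exact: mc.
  - rewrite [X in (X < _)%E](_ : _ = mu `[a, c])//.
    by rewrite lebesgue_measure_itv /=; case: ifP => // _; rewrite -EFinB ltry.
  - exact: measurable_funTS.
  - exists M; split; first exact: num_real.
    by move=> y My x _; apply: le_trans (h1M x) (ltW My).
pose H x := \int[mu]_(t in `[0, x]) h1 t.
have GH x : x <= b -> G x = H x.
  move=> xb; rewrite /H; have [_ ->] := integral_completed mh1 (ih1 0 x).
  have sub : `[0, x] `<=` `[0, b].
    by move=> y /=; rewrite !in_itv /= => /andP[-> yx]; rewrite (le_trans yx).
  rewrite /G /Rintegral; congr fine; apply: ae_eq_integral.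
  - exact: mc.
  - by apply/measurable_EFinP; apply: measurable_funS mg => //; exact: mc.
  - by apply/measurable_EFinP; exact: measurable_funTS.
  - by apply: filterS gh1 => y Hy /= /sub yb; rewrite Hy.
have imu a c : mu.-integrable `[a, c] (EFin \o h1).
  by have [] := integral_completed mh1 (ih1 a c).
split.
- by rewrite GH ?(ltW b0)// /H set_itv1 Rintegral_set1.
- move=> s t s0 st tb; rewrite !GH ?(le_trans st)//.
  have -> : H t - H s = \int[mu]_(x in `]s, t]) h1 x.
    by apply: Rintegral_itvB => //; rewrite bnd_simp.
  have muoo : (mu `]s, t] < +oo)%E.
    by rewrite lebesgue_measure_itv /=; case: ifP => // _; rewrite -EFinB ltry.
  have ist : mu.-integrable `]s, t] (EFin \o h1).
    by apply: integrableS (imu s t) => //; exact: subset_itv_oc_cc.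
  apply: le_trans (le_normr_Rintegral _ ist) _ => //.
  have -> : M * (t - s) = \int[mu]_(x in `]s, t]) (cst M) x.
    rewrite Rintegral_cst//= lebesgue_measure_itv /=; case: ifP => [//|].
    rewrite lte_fin; case: ltgtP st => // -> _ _.
    by rewrite subrr.
  apply: le_Rintegral => //.
  - exact: integrable_norm.
  - apply: measurable_bounded_integrable => //.
    exists M; split; first exact: num_real.
    by move=> y My x _ /=; rewrite ger0_norm// ltW.
- have loc : locally_integrable setT h1.
    have <- : h1 \_ `[0, b] = h1.
      by apply/funext => x; rewrite patchE; case: ifP => // xb; rewrite /h1 patchE xb.
    exact: integrable_locally.
  (* The differentiation theorem is stated for 0 < x. *)
  have : {ae leb R, forall x : R, x != 0}.
    apply: ae_completed; exists [set 0]; split => //.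
      exact: lebesgue_measure_set1.
    by move=> x /= /negP; rewrite negbK => /eqP.
  have := ae_completed (@FTC1 R h1 (BLeft 0) (imu 0) loc).
  apply: filterS3 gh1 => x gx Hx xn0 xb.
  move: (xb); rewrite in_itv /= => /andP[x0 xb'].
  have [|dH H'] := Hx; first by rewrite lte_fin lt0r xn0.
  apply/has_derivativeP => e e0.
  have [d d0 Hd] := derivable_eps dH H' e0.
  exists d => // y y0 yb yd; rewrite /modulus /= !GH// gx//.
  exact: Hd.
Qed.

End real_integral.

(** * The mean value inequality *)

Section creeping.
Variable R : realType.

(** The compactness of [s, t] as an induction principle: the supremum of the
    points that P links to s is linked to s, and is t because P holds around
    it. *)
Lemma interval_creeping (P : R -> R -> Prop) (s t : R) : s <= t ->
  (forall x y z, s <= x -> x <= y -> y <= z -> z <= t ->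
    P x y -> P y z -> P x z) ->
  (forall x, s <= x -> x <= t -> exists2 d : R, 0 < d &
    forall y z, s <= y -> y <= x -> x <= z -> z <= t -> z - y < d -> P y z) ->
  P s t.
Proof.
move=> st Ptrans Ploc.
pose S := [set x | [/\ s <= x, x <= t & P s x]].
have Pss : P s s.
  have [d d0] := Ploc s (lexx s) st.
  by apply => //; rewrite subrr.
have hsS : has_sup S.
  split; first by exists s.
  by exists t => x [].
pose c := sup S.
have sc : s <= c by apply: (sup_upper_bound hsS).
have ct : c <= t by apply: ge_sup; [exists s|move=> x []].
have [d d0 Hd] := Ploc c sc ct.
have [x [sx xt Psx] cx] := sup_adherent (divr_gt0 d0 (ltr0Sn R 1)) hsS.
have xc : x <= c by apply: (sup_upper_bound hsS).
rewrite -/c in cx.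
pose z := Num.min t (c + d / 3).
have cz : c <= z by rewrite /z le_min ct lerDl divr_ge0// ltW.
have zt : z <= t by rewrite /z ge_min lexx.
have zc : z <= c + d / 3 by rewrite /z ge_min lexx orbT.
have Psz : P s z.
  apply: (Ptrans s x z) => //; first exact: le_trans xc cz.
  by apply: Hd => //; lra.
have zc' : z <= c.
  by apply: (sup_upper_bound hsS); split => //; rewrite (le_trans sc).
have [td|td] := leP t (c + d / 3); first by rewrite /z min_l in Psz.
by exfalso; move: zc'; rewrite /z (min_r (ltW td)); lra.
Qed.

(** Non-overlapping intervals listed from left to right.  Sequences, unlike
    families indexed by some 'I_m, concatenate easily, which the gluing step of
    [mean_value_ineq_open] needs. *)
Definition chain (s t : R) (l : seq (R * R)) : bool :=
  all (fun p => [&& s <= p.1, p.1 < p.2 & p.2 <= t]) l &&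
  pairwise (fun p q => p.2 <= q.1) l.

Lemma chain_cat (x y z : R) l1 l2 : x <= y -> y <= z ->
  chain x y l1 -> chain y z l2 -> chain x z (l1 ++ l2).
Proof.
move=> xy yz /andP[/allP a1 p1] /andP[/allP a2 p2]; apply/andP; split.
  rewrite all_cat; apply/andP; split; apply/allP => p.
    by move=> /a1/and3P[-> -> py]; rewrite (le_trans py).
  by move=> /a2/and3P[yp -> ->]; rewrite (le_trans xy).
rewrite pairwise_cat p1 p2 !andbT; apply/allrelP => p q /a1/and3P[_ _ py].
by move=> /a2/and3P[yq _ _]; rewrite (le_trans py).
Qed.

Lemma chainW (s t s' t' : R) l : s' <= s -> t <= t' -> chain s t l -> chain s' t' l.
Proof.
move=> ss tt /andP[/allP a p]; apply/andP; split => //; apply/allP => q.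
by move=> /a/and3P[sq -> qt]; rewrite (le_trans ss)//= (le_trans qt).
Qed.

End creeping.

Lemma sub_split (V : zmodType) (p q x a c : V) :
  p - q = (p - x - a) - (q - x - c) + (a - c).
Proof. by rewrite [- (q - _ - _)]opprB addrAC !subrKA opprB subrKA. Qed.

Section mean_value.
Variables (R : realType) (k : scalar_kind).
Local Notation K := (scalar_field R k).
Local Notation mu := (@lebesgue_measure R).

Lemma absolutely_continuous_chain (b : R) (u : R -> K) :
  absolutely_continuous b u ->
  forall e : R, 0 < e -> exists2 d : R, 0 < d & forall l : seq (R * R),
    chain 0 b l -> \sum_(p <- l) (p.2 - p.1) < d ->
    \sum_(p <- l) modulus (u p.2 - u p.1) < e.
Proof.
move=> /absolutely_continuousP H e /H[d d0 Hd]; exists d => // l /andP[/allP al pl].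
have := Hd (size l) (fun i => (nth (0, 0) l i).1) (fun i => (nth (0, 0) l i).2).
rewrite !(big_nth (0, 0)) !big_mkord; apply => [i|i j ij].
  by have /al/and3P[] : nth (0, 0) l i \in l by apply: mem_nth.
have sep (i' j' : 'I_(size l)) : (i' < j')%N ->
    (nth (0, 0) l i').2 <= (nth (0, 0) l j').1.
  move: pl => /(pairwiseP (0, 0)) pl ij'; apply: pl => //; exact: ltn_ord.
rewrite -subset0 => x [/=]; rewrite !in_itv /= => /andP[xi ix] /andP[xj jx].
have [] := ltngtP i j => [/sep|/sep|/val_inj]; last by move/eqP: ij.
  by move=> /(lt_le_trans ix)/(lt_trans xj); rewrite ltxx.
by move=> /(lt_le_trans jx)/(lt_trans xi); rewrite ltxx.
Qed.

(** Outside the open set G the derivatives compare, hence so do the increments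
    over short intervals, up to a small slope.  A point of G has a neighbourhood
    inside G, and the increments over intervals inside G are put aside in a
    chain; the last hypothesis bounds their total. *)
Lemma mean_value_ineq_open (b s t : R) (u : R -> K) (phi : R -> R) :
  0 <= s -> s <= t -> t <= b ->
  (forall x y, s <= x -> x <= y -> y <= t -> phi x <= phi y) ->
  (forall e : R, 0 < e -> exists G : set R, [/\ open G,
    forall x, s <= x -> x <= t -> ~ G x -> exists v d,
      [/\ has_derivative b u x v, @has_derivative R RealScalars b phi x d &
        modulus v <= d] &
    forall l, chain s t l -> (\sum_(p <- l) (p.2 - p.1)%:E <= mu G)%E ->
      \sum_(p <- l) modulus (u p.2 - u p.1) < e]) ->
  modulus (u t - u s) <= phi t - phi s.
Proof.
move=> s0 st tb phi_nd H.
apply/ler_addgt0Pl => e e0.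
(* Half of [e] pays for the slope over [s, t], the other half for the chain. *)
pose e1 := e / 2 / (t - s + 1) / 2.
have ts1 : 0 < t - s + 1 by lra.
have e10 : 0 < e1 by rewrite !divr_gt0.
have [G [oG goodG smallG]] := H _ (divr_gt0 e0 (ltr0Sn R 1)).
have mG : measurable G by exact: open_measurable.
(* The measure of the part of G in a half-open interval is additive, so it is
   the budget that the chain may spend on its lengths. *)
pose P x y := exists2 l, chain x y l &
  (\sum_(p <- l) (p.2 - p.1)%:E <= mu (G `&` `]x, y]))%E /\
  modulus (u y - u x) <= phi y - phi x + 2 * e1 * (y - x) +
    \sum_(p <- l) modulus (u p.2 - u p.1).
have : P s t.
  apply: interval_creeping => // [x y z sx xy yz zt|x sx xt].
    move=> [l1 c1 [m1 b1]] [l2 c2 [m2 b2]]; exists (l1 ++ l2).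
      exact: chain_cat c1 c2.
    rewrite !big_cat /=; split.
      apply: le_trans (leeD m1 m2) _; rewrite -measureU.
      - apply: le_measure; rewrite ?inE.
        + by apply: measurableU; exact: measurableI.
        + exact: measurableI.
        rewrite -setIUr; apply: setIS => w /= [|]; rewrite !in_itv /= => /andP[].
          by move=> -> wy; rewrite (le_trans wy).
        by move=> yw ->; rewrite (le_lt_trans xy).
      - exact: measurableI.
      - exact: measurableI.
      - rewrite -subset0 => w /= [[_]]; rewrite !in_itv /= => /andP[_ wy] [_] /andP[yw _].
        by move: (lt_le_trans yw wy); rewrite ltxx.
    have -> : u z - u x = (u z - u y) + (u y - u x) by rewrite addrA subrK.
    apply: le_trans (modulusD _ _) _; lra.
  have [Gx|Gx] := pselect (G x).
    move/open_nbhs_nbhs : (conj oG Gx) => /nbhs_ballP[d /= d0 dG].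
    exists d => // y z sy yx xz zt yzd.
    have yz : y <= z by exact: le_trans yx xz.
    have phi_yz : phi y <= phi z by exact: phi_nd.
    have [->|yNz] := eqVneq y z.
      by exists [::] => //; rewrite !big_nil !subrr modulus0 mulr0 !addr0.
    have yz' : y < z by rewrite lt_neqAle yNz.
    exists [:: (y, z)]; first by rewrite /chain /= !lexx yz'.
    rewrite !big_seq1 /=; split.
      rewrite (_ : G `&` `]y, z] = `]y, z]%classic).
        by rewrite lebesgue_measure_itv /= lte_fin yz' EFinB.
      apply/setIidr => w /=; rewrite in_itv /= => /andP[yw wz].
      apply: dG; rewrite /ball /= ltr_norml; lra.
    have : 0 <= 2 * e1 * (z - y) by rewrite mulr_ge0 ?subr_ge0// mulr_ge0// ltW.
    lra.
  have [v [d [/has_derivativeP uv /has_derivativeP pd vd]]] := goodG x sx xt Gx.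
  have [d1 d10 H1] := uv _ e10.
  have [d2 d20 H2] := pd _ e10.
  exists (Num.min d1 d2) => [|y z sy yx xz zt]; first by rewrite lt_min d10.
  rewrite lt_min => /andP[yz1 yz2].
  exists [::] => //; rewrite !big_nil; split => //.
  have y0 : 0 <= y by lra.
  have zb : z <= b by lra.
  have yb : y <= b by lra.
  have z0 : 0 <= z by lra.
  have absz : `|z - x| = z - x by rewrite ger0_norm// subr_ge0.
  have absy : `|y - x| = x - y by rewrite distrC ger0_norm// subr_ge0.
  have zd1 : `|z - x| < d1 by rewrite absz; lra.
  have yd1 : `|y - x| < d1 by rewrite absy; lra.
  have zd2 : `|z - x| < d2 by rewrite absz; lra.
  have yd2 : `|y - x| < d2 by rewrite absy; lra.
  have := H1 z z0 zb zd1; have := H1 y y0 yb yd1.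
  have := H2 z z0 zb zd2; have := H2 y y0 yb yd2.
  rewrite absz absy {1 2}/modulus /= !ler_norml.
  move=> /andP[_ B1] /andP[B2 _] B3 B4.
  have -> : u z - u y = (u z - u x - of_real k (z - x) * v)
     - (u y - u x - of_real k (y - x) * v) + of_real k (z - y) * v.
    rewrite (_ : z - y = (z - x) - (y - x)); last by rewrite opprB addrA subrK.
    by rewrite (of_realB _ (z - x)) mulrBl -sub_split.
  apply: le_trans (modulusD _ _) _.
  have zy0 : 0 <= z - y by lra.
  rewrite modulusM modulus_of_real (ger0_norm zy0).
  have := modulusB (u z - u x - of_real k (z - x) * v) (u y - u x - of_real k (y - x) * v).
  have := ler_wpM2l zy0 vd.
  move: B1 B2 B3 B4.
  move: (modulus _) (modulus _) (modulus _) (modulus _) => m1 m2 m3 m4.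
  rewrite !mulrBl !mulrBr; lra.
move=> [l cl [ml bl]].
have : \sum_(p <- l) modulus (u p.2 - u p.1) < e / 2.
  apply: smallG => //; apply: le_trans ml _; apply: le_measure; rewrite ?inE//.
  exact: measurableI.
have : 2 * e1 * (t - s) <= e / 2.
  rewrite /e1 (_ : 2 * _ * _ = (e / 2) * ((t - s) / (t - s + 1))); last by field; lra.
  rewrite ler_piMr//; first by rewrite divr_ge0// ltW.
  by rewrite ler_pdivrMr// mul1r lerDl.
lra.
Qed.
End mean_value.

(** * Calculus on an interval *)

Section calculus.
Variables (R : realType) (k : scalar_kind) (b : R).
Local Notation K := (scalar_field R k).

(** The set G of [mean_value_ineq_open] is an open cover of the exceptional set,
    of measure below the modulus of absolute continuity of u. *)
Lemma mean_value_ineq (s t : R) (u : R -> K) (phi : R -> R) :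
  0 <= s -> s <= t -> t <= b -> absolutely_continuous b u ->
  (forall x y, s <= x -> x <= y -> y <= t -> phi x <= phi y) ->
  {ae leb R, forall x, s <= x -> x <= t -> exists v d,
      [/\ has_derivative b u x v, @has_derivative R RealScalars b phi x d &
        modulus v <= d]} ->
  modulus (u t - u s) <= phi t - phi s.
Proof.
move=> s0 st tb acu phi_nd uphi; apply: (@mean_value_ineq_open _ _ b) => // e e0.
have [d d0 Hd] := absolutely_continuous_chain acu e0.
have [G [oG Gd PG]] := ae_open_cover uphi d0.
exists G; split => // [x sx xt /PG|l cl lG]; first exact.
apply: Hd; first exact: chainW cl.
by rewrite -lte_fin -sumEFin; exact: le_lt_trans lG Gd.
Qed.

(** With no exceptional point G is empty, and so is every chain of total length
    at most its measure. *)
Lemma mean_value_ineq_everywhere (s t : R) (u : R -> K) (phi : R -> R) :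
  0 <= s -> s <= t -> t <= b ->
  (forall x y, s <= x -> x <= y -> y <= t -> phi x <= phi y) ->
  (forall x, s <= x -> x <= t -> exists v d,
      [/\ has_derivative b u x v, @has_derivative R RealScalars b phi x d &
        modulus v <= d]) ->
  modulus (u t - u s) <= phi t - phi s.
Proof.
move=> s0 st tb phi_nd uphi; apply: (@mean_value_ineq_open _ _ b) => // e e0.
exists set0; split => [|x sx xt _|l /andP[/allP al _]]; first exact: open0.
  exact: uphi.
rewrite measure0 sumEFin lee_fin; case: l al => [|p l] al; first by rewrite !big_nil.
have /al/and3P[_ pp _] := mem_head p l.
rewrite big_cons => l0; exfalso; move: l0; apply/negP; rewrite -ltNge.
rewrite ltr_wpDr ?subr_gt0// big_seq sumr_ge0// => q ql.
have /al/and3P[_ /ltW] : q \in p :: l by rewrite inE ql orbT.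
by rewrite subr_ge0.
Qed.

Lemma lipschitz_absolutely_continuous (M : R) (u : R -> K) :
  (forall s t, 0 <= s -> s <= t -> t <= b -> modulus (u t - u s) <= M * (t - s)) ->
  absolutely_continuous b u.
Proof.
move=> uM; apply/absolutely_continuousP => e e0.
exists (e / (`|M| + 1)); first by rewrite divr_gt0// ltr_wpDl.
move=> m x y xy _; rewrite ltr_pdivlMr ?ltr_wpDl// => sume.
apply: le_lt_trans sume; rewrite mulr_suml; apply: ler_sum => i _.
have [x0 [/ltW xyi yb]] := xy i.
apply: le_trans (uM _ _ x0 xyi yb) _; rewrite mulrC ler_wpM2l ?subr_ge0//.
by have := ler_norm M; lra.
Qed.

(** The case of a single interval in absolute continuity. *)
Lemma absolutely_continuous_uniform (u : R -> K) : absolutely_continuous b u ->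
  forall e : R, 0 < e -> exists2 d : R, 0 < d & forall x y, 0 <= x -> x <= b ->
    0 <= y -> y <= b -> `|y - x| < d -> modulus (u y - u x) < e.
Proof.
move=> /absolutely_continuous_chain H e e0; have [d d0 Hd] := H e e0.
exists d => //.
have key x y : 0 <= x -> y <= b -> x < y -> y - x < d -> modulus (u y - u x) < e.
  move=> x0 yb xy yxd; have := Hd [:: (x, y)]; rewrite !big_seq1 /=; apply => //.
  by rewrite /chain /= x0 yb xy.
move=> x y x0 xb y0 yb; have [xy|yx|->] := ltgtP x y.
- by rewrite ger0_norm ?subr_ge0 ?ltW//; exact: key.
- by rewrite distrC modulusBC ger0_norm ?subr_ge0 ?ltW//; exact: key.
- by move=> _; rewrite subrr modulus0.
Qed.

Lemma absolutely_continuous_bounded (u : R -> K) : absolutely_continuous b u ->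
  exists2 M : R, 0 <= M & forall x, 0 <= x -> x <= b -> modulus (u x) <= M.
Proof.
move=> /absolutely_continuous_uniform/(_ 1 ltr01)[d d0 Hd].
have [b0|b0] := leP 0 b; last first.
  by exists 0 => // x x0 xb; move: (le_trans x0 xb); rewrite leNgt b0.
suff [M HM] : exists M : R, forall x, 0 <= x -> x <= b -> modulus (u x) <= M.
  by exists M => //; exact: le_trans (modulus_ge0 _) (HM 0 (lexx 0) b0).
pose P s t := exists M : R, forall x, s <= x -> x <= t -> modulus (u x) <= M.
apply: (interval_creeping (P := P)) => // [x y z _ _ _ _ [M HM] [N HN]|x x0 xb].
  exists (Num.max M N) => w xw wz; rewrite le_max.
  have [wy|yw] := leP w y; first by rewrite HM.
  by rewrite HN ?orbT// ltW.
exists d => // y z y0 yx xz zb yzd; exists (modulus (u x) + 1) => w yw wz.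
have wx : `|w - x| < d by rewrite ltr_norml; apply/andP; split; lra.
have := Hd x w x0 xb (le_trans y0 yw) (le_trans wz zb) wx.
have := modulusD (u w - u x) (u x); rewrite subrK; lra.
Qed.

Lemma eq_absolutely_continuous (u v : R -> K) : (forall x, 0 <= x -> x <= b -> u x = v x) ->
  absolutely_continuous b u -> absolutely_continuous b v.
Proof.
move=> uv H e /H[d d0 Hd]; exists d => // m x y xy dis dl.
have := Hd m x y xy dis dl; congr (_ < _); apply: eq_bigr => i _.
have [x0 [xyi yb]] := xy i.
by rewrite !uv// ?(le_trans x0)// ?(le_trans _ yb)// ltW.
Qed.

Lemma absolutely_continuous_cst (c : K) : absolutely_continuous b (fun=> c).
Proof.
apply: (@lipschitz_absolutely_continuous 0) => s t _ _ _.
by rewrite subrr modulus0 mul0r.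
Qed.

Lemma absolutely_continuousD (u v : R -> K) : absolutely_continuous b u ->
  absolutely_continuous b v -> absolutely_continuous b (fun x => u x + v x).
Proof.
move=> /absolutely_continuousP Hu /absolutely_continuousP Hv.
apply/absolutely_continuousP => e e0; have e20 : 0 < e / 2 by rewrite divr_gt0.
have [d1 d10 H1] := Hu _ e20; have [d2 d20 H2] := Hv _ e20.
exists (Num.min d1 d2); first by rewrite lt_min d10.
move=> m x y xy dis; rewrite lt_min => /andP[l1 l2].
rewrite [X in _ < X](splitr e).
apply: le_lt_trans (ltrD (H1 m x y xy dis l1) (H2 m x y xy dis l2)).
rewrite -big_split /=; apply: ler_sum => i _.
by rewrite opprD addrACA modulusD.
Qed.

Lemma absolutely_continuousM (u v : R -> K) : absolutely_continuous b u ->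
  absolutely_continuous b v -> absolutely_continuous b (fun x => u x * v x).
Proof.
move=> acu acv.
have [M M0 HM] := absolutely_continuous_bounded acu.
have [N N0 HN] := absolutely_continuous_bounded acv.
move: acu acv => /absolutely_continuousP Hu /absolutely_continuousP Hv.
apply/absolutely_continuousP => e e0.
have c0 : 0 < M + N + 1 by rewrite ltr_wpDl// addr_ge0.
have e20 : 0 < e / (M + N + 1) by rewrite divr_gt0.
have [d1 d10 H1] := Hu _ e20; have [d2 d20 H2] := Hv _ e20.
exists (Num.min d1 d2); first by rewrite lt_min d10.
move=> m x y xy dis; rewrite lt_min => /andP[l1 l2].
have := H1 m x y xy dis l1; have := H2 m x y xy dis l2.
have : \sum_(i < m) modulus (u (y i) * v (y i) - u (x i) * v (x i)) <=
   N * (\sum_(i < m) modulus (u (y i) - u (x i))) +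
   M * (\sum_(i < m) modulus (v (y i) - v (x i))).
  rewrite !mulr_sumr -big_split /=; apply: ler_sum => i _.
  have [x0 [/ltW xyi yb]] := xy i.
  have -> : u (y i) * v (y i) - u (x i) * v (x i) =
      (u (y i) - u (x i)) * v (y i) + u (x i) * (v (y i) - v (x i)).
    by rewrite mulrBl mulrBr addrA subrK.
  apply: le_trans (modulusD _ _) _; rewrite !modulusM [_ * modulus (v _)]mulrC.
  apply: lerD; rewrite ler_wpM2r ?modulus_ge0//.
    exact: HN (le_trans x0 xyi) yb.
  exact: HM x0 (le_trans xyi yb).
move=> sumle Sv Su; apply: le_lt_trans sumle _.
have Su0 : 0 <= \sum_(i < m) modulus (u (y i) - u (x i)).
  by apply: sumr_ge0 => i _; exact: modulus_ge0.
have -> : e = (N + M + 1) * (e / (M + N + 1)).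
  by rewrite [N + M]addrC mulrC divfK// gt_eqF.
rewrite !mulrDl mul1r; apply: ltr_pwDr => //.
by apply: lerD; apply: ler_wpM2l => //; exact: ltW.
Qed.

Lemma has_derivative_cst (c : K) x : has_derivative b (fun=> c) x 0.
Proof.
apply/has_derivativeP => e e0; exists 1 => // y _ _ _.
by rewrite !subrr mulr0 subr0 modulus0 mulr_ge0// ltW.
Qed.

Lemma has_derivative_id x : has_derivative b (@of_real R k) x 1.
Proof.
apply/has_derivativeP => e e0; exists 1 => // y _ _ _.
by rewrite mulr1 -of_realB subrr modulus0 mulr_ge0// ltW.
Qed.

Lemma eq_has_derivative (u v : R -> K) x c : (forall y, 0 <= y -> y <= b -> u y = v y) ->
  0 <= x -> x <= b -> has_derivative b u x c -> has_derivative b v x c.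
Proof.
move=> uv x0 xb /has_derivativeP H; apply/has_derivativeP => e /H[d d0 Hd].
by exists d => // y y0 yb yd; rewrite -!uv//; exact: Hd.
Qed.

Lemma has_derivative_ext (u v : R -> K) x c d : u =1 v -> c = d ->
  has_derivative b u x c -> has_derivative b v x d.
Proof. by move=> /funext -> ->. Qed.

Lemma has_derivativeD (u v : R -> K) x c d : has_derivative b u x c ->
  has_derivative b v x d -> has_derivative b (fun y => u y + v y) x (c + d).
Proof.
have FF : Filter (within `[0, b] x^') by exact: within_filter.
move=> du dv; have := cvgD (FF := FF) du dv; rewrite /has_derivative.
set f := (X in X @ _ --> _); set g := (X in _ -> X @ _ --> _).
suff -> : g = f by [].
by apply/funext => y; rewrite /f /g /= opprD addrACA mulrDr.
Qed.

Lemma has_derivative_continuous (v : R -> K) x d : has_derivative b v x d ->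
  v y @[y --> within `[0, b] x^'] --> v x.
Proof.
move=> dv.
have FF : Filter (within `[0, b] x^') by exact: within_filter.
have lim0 : of_real k (y - x) @[y --> within `[0, b] x^'] --> (0 : K).
  apply/cvg_modulusP => e e0; rewrite near_withinE.
  apply/nbhs_ballP; exists e => //= y yx _ _.
  by rewrite sub0r modulusN modulus_of_real distrC.
have := cvgD (FF := FF) (cvgM (FF := FF) lim0 dv) (cvg_cst (FF := FF) (v x)).
rewrite mul0r add0r; apply: cvg_trans; apply: (near_eq_cvg (FF := FF)).
rewrite near_withinE; near=> y => _.
have yx0 : of_real k (y - x) != 0.
  rewrite -of_real0 (inj_eq (can_inj (@rpart_of_real R k))) subr_eq0.
  by near: y; exact: nbhs_dnbhs_neq.
by rewrite fctE /= of_realV mulVKf// subrK.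
Unshelve. all: by end_near. Qed.

Lemma has_derivativeM (u v : R -> K) x c d : has_derivative b u x c ->
  has_derivative b v x d ->
  has_derivative b (fun y => u y * v y) x (c * v x + u x * d).
Proof.
have FF : Filter (within `[0, b] x^') by exact: within_filter.
move=> du dv; have := cvgD (FF := FF) (cvgM (FF := FF) du (has_derivative_continuous dv))
  (cvgM (FF := FF) (cvg_cst (FF := FF) (u x)) dv).
rewrite /has_derivative.
set f := (X in X @ _ --> _); set g := (X in _ -> X @ _ --> _).
suff -> : g = f by [].
apply/funext => y; rewrite /f /g fctE /= [u x * (_ * _)]mulrCA -mulrA -mulrDr.
by congr (_ * _); rewrite mulrBl mulrBr addrA subrK.
Qed.

Lemma has_derivative_sum (I : Type) (r : seq I) (F : I -> R -> K) (D : I -> K) x :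
  (forall i, has_derivative b (F i) x (D i)) ->
  has_derivative b (fun y => \sum_(i <- r) F i y) x (\sum_(i <- r) D i).
Proof.
move=> FD; elim: r => [|i r IH].
  rewrite big_nil [X in has_derivative _ X](_ : _ = fun=> 0).
    exact: has_derivative_cst.
  by apply/funext => y; rewrite big_nil.
rewrite big_cons [X in has_derivative _ X](_ : _ = fun y => F i y + \sum_(j <- r) F j y).
  exact: has_derivativeD.
by apply/funext => y; rewrite big_cons.
Qed.

Lemma absolutely_continuous_sum (I : Type) (r : seq I) (F : I -> R -> K) :
  (forall i, absolutely_continuous b (F i)) ->
  absolutely_continuous b (fun y => \sum_(i <- r) F i y).
Proof.
move=> FD; elim: r => [|i r IH].
  rewrite [X in absolutely_continuous _ X](_ : _ = fun=> 0).
    exact: absolutely_continuous_cst.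
  by apply/funext => y; rewrite big_nil.
rewrite [X in absolutely_continuous _ X](_ : _ = fun y => F i y + \sum_(j <- r) F j y).
  exact: absolutely_continuousD.
by apply/funext => y; rewrite big_cons.
Qed.

Lemma has_derivative_unique (u : R -> K) x c d : 0 < b -> 0 <= x -> x <= b ->
  has_derivative b u x c -> has_derivative b u x d -> c = d.
Proof.
move=> b0 x0 xb.
suff FF : ProperFilter (within `[0, b] x^').
  move=> uc ud; apply: (@cvg_unique _ _ _ (fmap_proper_filter _ FF) _ _ uc ud).
  exact: norm_hausdorff.
apply: Build_ProperFilter_ex => P /nbhs_ballP[e /= e0 He].
have [xlt|xge] := ltP x b.
  pose y := Num.min b (x + e / 2).
  have yb : y <= b by rewrite /y ge_min lexx.
  have ye : y <= x + e / 2 by rewrite /y ge_min lexx orbT.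
  have xy : x < y by rewrite /y lt_min xlt ltrDl divr_gt0.
  exists y; apply: He; rewrite /ball /= ?in_itv /= ?yb ?gt_eqF// ?andbT; last lra.
  by rewrite distrC ger0_norm; lra.
pose y := Num.max 0 (x - e / 2).
have y0 : 0 <= y by rewrite /y le_max lexx.
have ye : x - e / 2 <= y by rewrite /y le_max lexx orbT.
have yx : y < x by rewrite /y gt_max gtrBl divr_gt0// andbT; lra.
exists y; apply: He; rewrite /ball /= ?in_itv /= ?y0 ?lt_eqF//; last lra.
by rewrite ger0_norm; lra.
Qed.

End calculus.

(** * Bounded integrable scalar functions *)

Section integrals.
Variables (R : realType) (k : scalar_kind) (b : R).
Hypothesis b_gt0 : 0 < b.
Local Notation K := (scalar_field R k).
Local Notation measurable_part p f :=
  (@measurable_fun _ _ (lebesgueType R) (measurableTypeR R) `[0, b]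
    (fun x => p (f x))).

Lemma bounded_measurable_integrable (g : R -> R) (M : R) :
  (forall x, 0 <= x -> x <= b -> `|g x| <= M) -> measurable_part id g ->
  (leb R).-integrable `[0, b] (EFin \o g).
Proof.
move=> gM mg; apply: measurable_bounded_integrable => //.
- by apply: sub_caratheodory; exact: measurable_itv.
- rewrite [X in (X < _)%E](_ : _ = @lebesgue_measure R `[0, b])//.
  by rewrite lebesgue_measure_itv /=; case: ifP => // _; rewrite -EFinB ltry.
- exists M; split; first exact: num_real.
  move=> y My x /=; rewrite in_itv /= => /andP[x0 xb].
  by apply: le_trans (gM x x0 xb) (ltW My).
Qed.

(** As [0, b] has finite measure, integrability of a bounded function is
    measurability of its coordinates, a property that passes to products. *)
Lemma bounded_integrableP (f : R -> K) : bounded_integrable b f <->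
  [/\ exists M : R, forall x, 0 <= x -> x <= b -> modulus (f x) <= M,
      measurable_part (@rpart R k) f & measurable_part (@ipart R k) f].
Proof.
split=> [[[M [Mreal HM]] H]|[[M HM] mr mi]]; last first.
  split.
    exists (of_real k M); split.
      have [M0|M0] := leP 0 M; first by rewrite ger0_real// -(of_real0 R k) (ler_of_real k).
      by rewrite ltr0_real// -(of_real0 R k) (ltr_of_real k).
    move=> y My x /=; rewrite in_itv /= => /andP[x0 xb].
    by rewrite norm_modulus (le_trans _ (ltW My))// (ler_of_real k) HM.
  have HMr x : 0 <= x -> x <= b -> `|rpart (f x)| <= M.
    by move=> x0 xb; exact: le_trans (ler_rpart _) (HM x x0 xb).
  have HMi x : 0 <= x -> x <= b -> `|ipart (f x)| <= M.
    by move=> x0 xb; exact: le_trans (ler_ipart _) (HM x x0 xb).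
  move: (bounded_measurable_integrable HMr mr) (bounded_measurable_integrable HMi mi).
  rewrite /scalar_integrable /rpart /ipart.
  by clear; move: f; case: k.
split.
- have [r _ rE] : exists2 r : R, 0 < r & `|M| + 1 = of_real k r.
    by apply: of_real_pos; rewrite ltr_wpDl.
  exists r => x x0 xb; rewrite -(ler_of_real k) -rE -norm_modulus.
  apply: HM; last by rewrite /= in_itv /= x0.
  by apply: le_lt_trans (real_ler_norm Mreal) _; rewrite ltrDl ltr01.
- move: H; rewrite /scalar_integrable /rpart; clear; move: f; case: k => f H.
    by apply/measurable_EFinP; exact: measurable_int H.
  by apply/measurable_EFinP; exact: measurable_int H.1.
- move: H; rewrite /scalar_integrable /ipart; clear; move: f; case: k => f H.
    exact: measurable_cst.
  by apply/measurable_EFinP; exact: measurable_int H.2.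
Qed.

Lemma bounded_integrableD (f g : R -> K) : bounded_integrable b f ->
  bounded_integrable b g -> bounded_integrable b (fun x => f x + g x).
Proof.
move=> /bounded_integrableP[[M HM] rf jf] /bounded_integrableP[[N HN] rg jg].
apply/bounded_integrableP; split.
- exists (M + N) => x x0 xb; apply: le_trans (modulusD _ _) _.
  by apply: lerD; [exact: HM|exact: HN].
- have -> : (fun x => rpart (f x + g x)) = (fun x => rpart (f x) + rpart (g x)).
    by apply/funext => x; rewrite rpartD.
  exact: measurable_funD.
- have -> : (fun x => ipart (f x + g x)) = (fun x => ipart (f x) + ipart (g x)).
    by apply/funext => x; rewrite ipartD.
  exact: measurable_funD.
Qed.

Lemma bounded_integrableN (f : R -> K) : bounded_integrable b f ->
  bounded_integrable b (fun x => - f x).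
Proof.
move=> /bounded_integrableP[[M HM] rf jf]; apply/bounded_integrableP; split.
- by exists M => x x0 xb; rewrite modulusN; exact: HM.
- have -> : (fun x => rpart (- f x)) = (fun x => - rpart (f x)).
    by apply/funext => x; rewrite rpartN.
  exact: measurableT_comp.
- have -> : (fun x => ipart (- f x)) = (fun x => - ipart (f x)).
    by apply/funext => x; rewrite ipartN.
  exact: measurableT_comp.
Qed.

Lemma bounded_integrableM (f g : R -> K) : bounded_integrable b f ->
  bounded_integrable b g -> bounded_integrable b (fun x => f x * g x).
Proof.
move=> /bounded_integrableP[[M HM] rf jf] /bounded_integrableP[[N HN] rg jg].
apply/bounded_integrableP; split.
- exists (M * N) => x x0 xb; rewrite modulusM.
  by apply: ler_pM; [exact: modulus_ge0|exact: modulus_ge0|exact: HM|exact: HN].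
- have -> : (fun x => rpart (f x * g x)) =
      (fun x => rpart (f x) * rpart (g x) - ipart (f x) * ipart (g x)).
    by apply/funext => x; rewrite rpartM.
  apply: measurable_funB; exact: measurable_funM.
- have -> : (fun x => ipart (f x * g x)) =
      (fun x => rpart (f x) * ipart (g x) + ipart (f x) * rpart (g x)).
    by apply/funext => x; rewrite ipartM.
  apply: measurable_funD; exact: measurable_funM.
Qed.

Lemma absolutely_continuous_bounded_integrable (u : R -> K) :
  absolutely_continuous b u -> bounded_integrable b u.
Proof.
move=> acu; have [M _ HM] := absolutely_continuous_bounded acu.
have cont (p : K -> R) : (forall z w, `|p z - p w| <= modulus (z - w)) ->
    measurable_part p u.
  move=> pmod.
  have : @measurable_fun _ _ (measurableTypeR R) (measurableTypeR R) `[0, b] (fun x => p (u x)).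
    apply: subspace_continuous_measurable_fun => //.
    apply/subspace_continuousP => x /=; rewrite in_itv /= => /andP[x0 xb].
    apply/cvgrPdist_lt => e e0; rewrite near_withinE.
    have [d d0 Hd] := absolutely_continuous_uniform acu e0.
    apply/nbhs_ballP; exists d => //= y yd; rewrite in_itv /= => /andP[y0 yb].
    by apply: le_lt_trans (pmod _ _) _; exact: Hd.
  by move=> H; move=> mD Y mY; apply: sub_caratheodory; exact: H.
apply/bounded_integrableP; split; first by exists M.
- by apply: cont => z w; rewrite -rpartN -rpartD ler_rpart.
- by apply: cont => z w; rewrite -ipartN -ipartD ler_ipart.
Qed.

Lemma rpart_scalar_integral (D : set R) (f : R -> K) :
  rpart (scalar_integral D f) = \int[leb R]_(t in D) rpart (f t).
Proof. by rewrite /scalar_integral /rpart; move: f; case: k. Qed.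

Lemma ipart_scalar_integral (D : set R) (f : R -> K) :
  ipart (scalar_integral D f) = \int[leb R]_(t in D) ipart (f t).
Proof.
rewrite /scalar_integral /ipart; move: f; case: k => // _.
by rewrite /Rintegral integral0.
Qed.

(** Both coordinates are indefinite integrals of bounded real functions. *)
Lemma scalar_integral_primitive (g : R -> K) : bounded_integrable b g ->
  let G x := scalar_integral `[0, x] g in
  [/\ G 0 = 0, absolutely_continuous b G &
    {ae leb R, forall x, x \in `[0, b] -> has_derivative b G x (g x)}].
Proof.
move=> /bounded_integrableP[[M HM] mr mi] G.
have HMr x : 0 <= x -> x <= b -> `|rpart (g x)| <= M.
  by move=> x0 xb; exact: le_trans (ler_rpart _) (HM x x0 xb).
have HMi x : 0 <= x -> x <= b -> `|ipart (g x)| <= M.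
  by move=> x0 xb; exact: le_trans (ler_ipart _) (HM x x0 xb).
have [r0 rlip rder] := real_integral_primitive b_gt0
  (bounded_measurable_integrable HMr mr) HMr.
have [i0 ilip ider] := real_integral_primitive b_gt0
  (bounded_measurable_integrable HMi mi) HMi.
split.
- apply: modulus_le0; apply: le_trans (ler_modulus _) _.
  by rewrite rpart_scalar_integral ipart_scalar_integral r0 i0 normr0 addr0.
- apply: (@lipschitz_absolutely_continuous _ _ _ (M + M)) => s t s0 st tb.
  apply: le_trans (ler_modulus _) _; rewrite mulrDl.
  rewrite rpartD rpartN ipartD ipartN !rpart_scalar_integral !ipart_scalar_integral.
  by apply: lerD; [exact: rlip|exact: ilip].
- apply: filterS2 rder ider => x rx ix xb.
  have /has_derivativeP {}rx := rx xb; have /has_derivativeP {}ix := ix xb.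
  apply/has_derivativeP => e e0; have e20 : 0 < e / 2 by rewrite divr_gt0.
  have [d1 d10 H1] := rx _ e20; have [d2 d20 H2] := ix _ e20.
  exists (Num.min d1 d2); first by rewrite lt_min d10.
  move=> y y0 yb; rewrite lt_min => /andP[yd1 yd2].
  apply: le_trans (ler_modulus _) _.
  rewrite !(rpartD, rpartN, ipartD, ipartN, rpartM, ipartM).
  rewrite !rpart_scalar_integral !ipart_scalar_integral rpart_of_real ipart_of_real.
  rewrite !mul0r subr0 addr0 [e in leRHS]splitr [leRHS]mulrDl.
  by apply: lerD; [exact: H1|exact: H2].
Qed.

End integrals.

(** * Primitives of matrix functions *)

Section matrix_primitives.
Variables (R : realType) (k : scalar_kind) (b : R).
Hypothesis b_gt0 : 0 < b.
Local Notation K := (scalar_field R k).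

(** Solutions of the system, terms of the series and indefinite integrals are all
    handled through this relation between U and its derivative V. *)
Definition primitive (m n : nat) (U V : R -> 'M[K]_(m, n)) : Prop :=
  (forall i j, absolutely_continuous b (fun x => U x i j)) /\
  {ae leb R, forall x, x \in `[0, b] ->
    forall i j, has_derivative b (fun y => U y i j) x (V x i j)}.

Definition mx_bounded_integrable (m n : nat) (M : R -> 'M[K]_(m, n)) : Prop :=
  forall i j, bounded_integrable b (fun x => M x i j).

Lemma ae_forall_fin (I : finType) (P : I -> R -> Prop) :
  (forall i, {ae leb R, forall x, P i x}) -> {ae leb R, forall x, forall i, P i x}.
Proof.
move=> H; suff : {ae leb R, forall x, forall i, i \in enum I -> P i x}.
  by apply: filterS => x Hx i; apply: Hx; rewrite mem_enum.
elim: (enum I) => [|i s IH]; first exact: nearW.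
apply: filterS2 IH (H i) => x Hs Hi j; rewrite inE => /orP[/eqP ->//|js].
exact: Hs.
Qed.

Lemma bounded_integrable_cst (c : K) : bounded_integrable b (fun=> c).
Proof.
apply: absolutely_continuous_bounded_integrable => //.
exact: absolutely_continuous_cst.
Qed.

Lemma bounded_integrable_sum (I : Type) (r : seq I) (F : I -> R -> K) :
  (forall i, bounded_integrable b (F i)) ->
  bounded_integrable b (fun x => \sum_(i <- r) F i x).
Proof.
move=> FB; elim: r => [|i r IH].
  rewrite [X in bounded_integrable _ X](_ : _ = fun=> 0).
    exact: bounded_integrable_cst.
  by apply/funext => y; rewrite big_nil.
rewrite [X in bounded_integrable _ X](_ : _ = fun y => F i y + \sum_(j <- r) F j y).
  exact: bounded_integrableD.
by apply/funext => y; rewrite big_cons.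
Qed.

Lemma mx_bounded_integrableM (m n p : nat) (M : R -> 'M[K]_(m, n))
    (N : R -> 'M[K]_(n, p)) :
  mx_bounded_integrable M -> mx_bounded_integrable N ->
  mx_bounded_integrable (fun x => M x *m N x).
Proof.
move=> HM HN i j.
rewrite [X in bounded_integrable _ X](_ : _ = fun y => \sum_l M y i l * N y l j).
  by apply: bounded_integrable_sum => l; exact: bounded_integrableM.
by apply/funext => y; rewrite mxE.
Qed.

Lemma mx_bounded_integrableN (m n : nat) (M : R -> 'M[K]_(m, n)) :
  mx_bounded_integrable M -> mx_bounded_integrable (fun x => - M x).
Proof.
move=> HM i j.
rewrite [X in bounded_integrable _ X](_ : _ = fun y => - M y i j).
  exact: bounded_integrableN.
by apply/funext => y; rewrite mxE.
Qed.

Lemma mx_bounded_integrableT (m n : nat) (M : R -> 'M[K]_(m, n)) :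
  mx_bounded_integrable M -> mx_bounded_integrable (fun x => (M x)^T).
Proof.
move=> HM i j.
rewrite [X in bounded_integrable _ X](_ : _ = fun y => M y j i)//.
by apply/funext => y; rewrite mxE.
Qed.

Lemma primitive_bounded_integrable (m n : nat) (U V : R -> 'M[K]_(m, n)) :
  primitive U V -> mx_bounded_integrable U.
Proof.
by move=> [acU _] i j; exact: absolutely_continuous_bounded_integrable.
Qed.

Lemma primitive_integral (m n : nat) (M : R -> 'M[K]_(m, n)) :
  mx_bounded_integrable M ->
  primitive (fun x => mx_integral x M) M /\ mx_integral 0 M = 0.
Proof.
move=> HM.
have E i j : (fun x => mx_integral x M i j) =
    (fun x => scalar_integral `[0, x] (fun t => M t i j)).
  by apply/funext => x; rewrite mxE.
split; last first.
  by apply/matrixP => i j; rewrite !mxE; have [] := scalar_integral_primitive b_gt0 (HM i j).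
split=> [i j|].
  by rewrite E; have [] := scalar_integral_primitive b_gt0 (HM i j).
have : {ae leb R, forall x, forall ij : 'I_m * 'I_n, x \in `[0, b] ->
    has_derivative b (fun y => mx_integral y M ij.1 ij.2) x (M x ij.1 ij.2)}.
  apply: ae_forall_fin => -[i j] /=; rewrite E.
  by have [] := scalar_integral_primitive b_gt0 (HM i j).
by apply: filterS => x H xb i j; exact: (H (i, j) xb).
Qed.

Lemma eq_primitive (m n : nat) (U V U' V' : R -> 'M[K]_(m, n)) :
  (forall x, x \in `[0, b] -> U x = U' x) ->
  (forall x, x \in `[0, b] -> V x = V' x) -> primitive U V -> primitive U' V'.
Proof.
move=> UU' VV' [acU dU].
have UE i j x : 0 <= x -> x <= b -> U x i j = U' x i j.
  by move=> x0 xb; rewrite UU'// in_itv /= x0.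
split=> [i j|]; first by apply: eq_absolutely_continuous (acU i j) => x; exact: UE.
apply: filterS dU => x Hx xb i j; rewrite -VV'//.
move: (xb); rewrite in_itv /= => /andP[x0 xb'].
by apply: eq_has_derivative (Hx xb i j) => // y; exact: UE.
Qed.

Lemma primitive_cst (m n : nat) (C : 'M[K]_(m, n)) : primitive (fun=> C) (fun=> 0).
Proof.
split=> [i j|]; first exact: absolutely_continuous_cst.
by apply: nearW => x _ i j; rewrite mxE; exact: has_derivative_cst.
Qed.

Lemma primitiveD (m n : nat) (U V U' V' : R -> 'M[K]_(m, n)) :
  primitive U V -> primitive U' V' ->
  primitive (fun x => U x + U' x) (fun x => V x + V' x).
Proof.
move=> [acU dU] [acU' dU'].
have E i j : (fun x => (U x + U' x) i j) = (fun x => U x i j + U' x i j).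
  by apply/funext => x; rewrite mxE.
split=> [i j|]; first by rewrite E; exact: absolutely_continuousD.
apply: filterS2 dU dU' => x Hx Hx' xb i j; rewrite E mxE.
by apply: has_derivativeD; [exact: Hx|exact: Hx'].
Qed.

Lemma primitiveM (m n p : nat) (U V : R -> 'M[K]_(m, n)) (U' V' : R -> 'M[K]_(n, p)) :
  primitive U V -> primitive U' V' ->
  primitive (fun x => U x *m U' x) (fun x => V x *m U' x + U x *m V' x).
Proof.
move=> [acU dU] [acU' dU'].
have E i j : (fun x => (U x *m U' x) i j) = (fun x => \sum_l U x i l * U' x l j).
  by apply/funext => x; rewrite mxE.
split=> [i j|].
  by rewrite E; apply: absolutely_continuous_sum => l; exact: absolutely_continuousM.
apply: filterS2 dU dU' => x Hx Hx' xb i j; rewrite E !mxE -big_split /=.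
apply: has_derivative_sum => l; apply: has_derivativeM; [exact: Hx|exact: Hx'].
Qed.

Lemma primitiveB (m n : nat) (U V U' V' : R -> 'M[K]_(m, n)) :
  primitive U V -> primitive U' V' ->
  primitive (fun x => U x - U' x) (fun x => V x - V' x).
Proof.
move=> pU pU'.
apply: eq_primitive (primitiveD pU (primitiveM (primitive_cst (- 1%:M)) pU')) => x _.
  by rewrite mulNmx mul1mx.
by rewrite mul0mx add0r mulNmx mul1mx.
Qed.

Lemma primitiveT (m n : nat) (U V : R -> 'M[K]_(m, n)) : primitive U V ->
  primitive (fun x => (U x)^T) (fun x => (V x)^T).
Proof.
move=> [acU dU].
have E i j : (fun x => (U x)^T i j) = (fun x => U x j i).
  by apply/funext => x; rewrite mxE.
split=> [i j|]; first by rewrite E.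
by apply: filterS dU => x Hx xb i j; rewrite E mxE; exact: Hx.
Qed.

(** Entrywise, so that no matrix norm is needed. *)
Lemma primitive_mean_value (m n : nat) (U V : R -> 'M[K]_(m, n)) (phi d : R -> R) i j :
  primitive U V ->
  (forall x y, 0 <= x -> x <= y -> y <= b -> phi x <= phi y) ->
  (forall x, x \in `[0, b] -> @has_derivative R RealScalars b phi x (d x)) ->
  (forall x, x \in `[0, b] -> modulus (V x i j) <= d x) ->
  forall s t, 0 <= s -> s <= t -> t <= b ->
  modulus (U t i j - U s i j) <= phi t - phi s.
Proof.
move=> [acU dU] phi_nd dphi Vd s t s0 st tb.
apply: (mean_value_ineq (b := b) (u := fun x => U x i j)) => //.
  by move=> x y sx xy yt; apply: phi_nd => //; [exact: le_trans sx|exact: le_trans tb].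
apply: filterS dU => x Hx sx xt.
have xb : x \in `[0, b] by rewrite in_itv /= (le_trans s0 sx) (le_trans xt tb).
by exists (V x i j), (d x); split; [exact: Hx|exact: dphi|exact: Vd].
Qed.

Lemma primitive_lipschitz (m n : nat) (U V : R -> 'M[K]_(m, n)) (M : R) i j :
  0 <= M -> primitive U V ->
  (forall x, x \in `[0, b] -> modulus (V x i j) <= M) ->
  forall s t, 0 <= s -> s <= t -> t <= b ->
  modulus (U t i j - U s i j) <= M * (t - s).
Proof.
move=> M0 pU VM s t s0 st tb; rewrite mulrBr.
apply: (primitive_mean_value (phi := fun x => M * x) (d := fun=> M) pU) => //.
  by move=> x y _ xy _; rewrite ler_wpM2l.
move=> x _; rewrite -[X in has_derivative _ _ _ X]addr0.
apply/has_derivativeP => e e0; exists 1 => // y _ _ _.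
by rewrite addr0 -mulrBr [(y - x) * _]mulrC subrr modulus0 mulr_ge0// ltW.
Qed.

(** The difference of two primitives is Lipschitz with constant 0. *)
Lemma primitive_unique (m n : nat) (U W V : R -> 'M[K]_(m, n)) :
  primitive U V -> primitive W V -> U 0 = W 0 ->
  forall x, x \in `[0, b] -> U x = W x.
Proof.
move=> pU pW UW0 x; rewrite in_itv /= => /andP[x0 xb].
have pD := primitiveB pU pW.
apply/matrixP => i j; apply/eqP; rewrite -subr_eq0; apply/eqP; apply: modulus_le0.
have := @primitive_lipschitz _ _ _ _ 0 i j (lexx 0) pD _ 0 x (lexx 0) x0 xb.
rewrite /= UW0 !subrr mul0r !mxE subr0; apply => y _.
by rewrite subrr mxE modulus0.
Qed.

End matrix_primitives.

(** * The series E *)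

Section dominated_series.
Variables (R : realType) (k : scalar_kind).
Local Notation K := (scalar_field R k).

(** The coordinates converge absolutely.  The bound on the remainder does not
    involve z, which gives uniform convergence when z depends on a parameter and
    c does not. *)
Lemma cvg_series_dominated (z : nat -> K) (c : nat -> R) :
  (forall p, modulus (z p) <= c p) -> cvgn (series c) ->
  exists2 l : K, series z @ \oo --> l &
    forall N, modulus (l - series z N) <= limn (series c) - series c N.
Proof.
move=> zc cc.
have parts (p : K -> R) : (forall w, `|p w| <= modulus w) ->
    cvgn (series (fun n => p (z n))).
  move=> pm; apply: normed_cvg; apply: series_le_cvg cc => n /=.
  - exact: normr_ge0.
  - by apply: le_trans (zc n); exact: modulus_ge0.
  - by apply: le_trans (zc n); exact: pm.
have part_sum (p : K -> R) n : {morph p : x y / x + y} -> p 0 = 0 ->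
    p (series z n) = series (fun n => p (z n)) n.
  by move=> pD p0; rewrite /series /= (big_morph p pD p0).
have r0 : rpart (0 : K) = 0 by rewrite -(of_real0 R k) rpart_of_real.
have i0 : ipart (0 : K) = 0 by rewrite -(of_real0 R k) ipart_of_real.
have [l [rl il]] : exists l : K,
    rpart l = limn (series (fun n => rpart (z n))) /\
    ipart l = limn (series (fun n => ipart (z n))).
  move: (limn (series (fun n => rpart (z n)))) => x.
  have := parts (@ipart R k) (@ler_ipart R k).
  rewrite /rpart /ipart; clear; move: z; case: k => [z _|z _].
    exists x; split => //; apply/esym/cvg_lim => //.
    rewrite (_ : series _ = fun=> 0); first exact: cvg_cst.
    by apply/funext => n; rewrite /series /= big1.
  by exists (x +i* limn (series (fun n => complex.Im (z n))))%C.
have cl : series z @ \oo --> l.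
  apply/cvg_seq_modulusP => e e0; have e20 : 0 < e / 2 by rewrite divr_gt0.
  have : series (fun n => rpart (z n)) @ \oo --> rpart l.
    by rewrite rl; exact: parts (@rpart R k) (@ler_rpart R k).
  move=> /cvgrPdist_lt/(_ _ e20)[N1 _ H1].
  have : series (fun n => ipart (z n)) @ \oo --> ipart l.
    by rewrite il; exact: parts (@ipart R k) (@ler_ipart R k).
  move=> /cvgrPdist_lt/(_ _ e20)[N2 _ H2].
  exists (maxn N1 N2) => n; rewrite geq_max => /andP[n1 n2].
  apply: le_lt_trans (ler_modulus _) _; rewrite rpartD ipartD rpartN ipartN.
  rewrite (part_sum _ _ (@rpartD R k) r0) (part_sum _ _ (@ipartD R k) i0).
  by rewrite [e]splitr; apply: ltrD; [exact: H1|exact: H2].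
exists l => // N; apply/ler_addgt0Pr => e e0.
have [n Hn] := (cvg_seq_modulusP _ _).1 cl e e0.
have Nn := leq_maxl N n; have nn := leq_maxr N n; move: (maxn N n) Nn nn => m Nm nm.
have -> : l - series z N = (l - series z m) + (series z m - series z N).
  by rewrite addrA subrK.
apply: le_trans (modulusD _ _) _; rewrite [leRHS]addrC; apply: lerD.
  by apply: ltW; exact: Hn.
have -> : series z m - series z N = \sum_(N <= p < m) z p.
  exact: sub_series_geq.
apply: le_trans (modulus_sum _ _ _) _.
apply: le_trans (ler_sum _ (fun p _ => zc p)) _.
rewrite -(sub_series_geq c Nm) lerD2r.
apply: nondecreasing_cvgn_le => //; apply/nondecreasing_seqP => p.
rewrite /series /= big_nat_recr//= lerDl.
by apply: le_trans (zc p); exact: modulus_ge0.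
Qed.

End dominated_series.

Lemma has_derivative_exp_coeff (R : realType) (b a x : R) p :
  @has_derivative R RealScalars b (fun y => exp_coeff (a * y) p.+1) x
    (a * exp_coeff (a * x) p).
Proof.
have dX q : @has_derivative R RealScalars b (fun y => y ^+ q.+1) x (q.+1%:R * x ^+ q).
  elim: q => [|q IH].
    rewrite expr0 mulr1; exact: has_derivative_id.
  apply: has_derivative_ext (has_derivativeM (@has_derivative_id R RealScalars b x) IH).
    by move=> y; rewrite [RHS]exprS.
  by rewrite /= mul1r mulrCA -exprS [in RHS]mulrS mulrDl mul1r.
pose c : scalar_field R RealScalars := a ^+ p.+1 / p.+1`!%:R.
apply: has_derivative_ext (has_derivativeM (has_derivative_cst b c x) (dX p)).
  by move=> y; rewrite /exp_coeff /= exprMn mulrAC.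
rewrite mul0r add0r /c /exp_coeff /= exprMn factS natrM exprS.
have pn : (p.+1%:R : R) != 0 by rewrite pnatr_eq0.
have fn : (p`!%:R : R) != 0 by rewrite pnatr_eq0 -lt0n fact_gt0.
by field; rewrite fn nat1r pn.
Qed.

Section Eseries.
Variables (R : realType) (k : scalar_kind) (b : R).
Hypothesis b_gt0 : 0 < b.
Local Notation K := (scalar_field R k).
Variables (n : nat) (A : R -> 'M[K]_n).
Hypothesis A_bi : mx_bounded_integrable b A.

Let A_bounded : exists2 M : R, 0 <= M &
  forall x, x \in `[0, b] -> forall i j, modulus (A x i j) <= M.
Proof.
have /choice[M HM] : forall ij : 'I_n * 'I_n, exists M : R,
    forall x, x \in `[0, b] -> modulus (A x ij.1 ij.2) <= M.
  move=> [i j]; have /bounded_integrableP[[M HM] _ _] := A_bi i j.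
  by exists M => x; rewrite in_itv /= => /andP[]; exact: HM.
(* One bound for all the entries. *)
exists (\sum_ij `|M ij|); first exact: sumr_ge0.
move=> x xb i j; apply: le_trans (HM (i, j) x xb) _.
rewrite (bigD1 (i, j))//= (le_trans (ler_norm _))// lerDl.
exact: sumr_ge0.
Qed.

Let M := sval (cid2 A_bounded).
Let M_ge0 : 0 <= M. Proof. by rewrite /M; case: cid2. Qed.
Let A_le_M x i j : x \in `[0, b] -> modulus (A x i j) <= M.
Proof. by rewrite /M; case: cid2 => /= ? _ H xb; exact: H. Qed.
Let L := n%:R * M.
Let L_ge0 : 0 <= L. Proof. by rewrite mulr_ge0. Qed.

Let modulus_A_mul p (B : 'M[K]_(n, p)) (beta : R) x i j : x \in `[0, b] ->
  (forall l, modulus (B l j) <= beta) -> modulus ((A x *m B) i j) <= L * beta.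
Proof.
move=> xb HB; rewrite mxE; apply: le_trans (modulus_sum _ _ _) _.
apply: (@le_trans _ _ (\sum_(l < n) M * beta)).
  apply: ler_sum => l _; rewrite modulusM; apply: ler_pM => //; try exact: modulus_ge0.
  exact: A_le_M.
by rewrite sumr_const card_ord -mulr_natl mulrA.
Qed.

Lemma Eterm_primitive p :
  primitive b (Eterm A p.+1) (fun x => A x *m Eterm A p x) /\ Eterm A p.+1 0 = 0.
Proof.
suff E_bi : mx_bounded_integrable b (Eterm A p).
  by apply: primitive_integral => //; exact: mx_bounded_integrableM.
elim: p => [i j|p IH]; first exact: bounded_integrable_cst.
apply: primitive_bounded_integrable => //.
by apply: (primitive_integral _ _).1 => //; exact: mx_bounded_integrableM.
Qed.

Let c p := exp_coeff (L * b) p.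
Let C := limn (series c).
Let tail N := C - series c N.

Let exp_coeff_nd p x y : 0 <= x -> x <= y ->
  exp_coeff (L * x) p <= exp_coeff (L * y) p.
Proof.
move=> x0 xy; rewrite /exp_coeff /= ler_wpM2r ?invr_ge0//.
by rewrite lerXn2r ?nnegrE ?mulr_ge0 ?ler_wpM2l// (le_trans x0).
Qed.

(** By induction E_(p+1)' = A E_p is bounded by L (L x)^p / p!, the derivative of
    (L x)^(p+1) / (p+1)!, and E_(p+1) 0 = 0. *)
Lemma Eterm_le p x i j : x \in `[0, b] ->
  modulus (Eterm A p x i j) <= exp_coeff (L * x) p.
Proof.
elim: p x i j => [|p IH] x i j xb.
  rewrite /exp_coeff /= expr0 fact0 divr1 mxE.
  by case: (i == j); rewrite ?modulus1 ?modulus0.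
have [pE E0] := Eterm_primitive p.
move: (xb); rewrite in_itv /= => /andP[x0 xb'].
have := primitive_mean_value (i := i) (j := j) pE
  (fun x y x0 xy _ => exp_coeff_nd p.+1 x0 xy)
  (fun x _ => @has_derivative_exp_coeff R b L x p)
  (fun x xb => modulus_A_mul _ xb (fun l => IH x l j xb)) (lexx 0) x0 xb'.
have O0 : (0 : 'M[K]_n) i j = 0 by rewrite mxE.
by rewrite E0 O0 subr0 /exp_coeff /= mulr0 expr0n /= mul0r subr0.
Qed.

Let E_lec p x i j : x \in `[0, b] -> modulus (Eterm A p x i j) <= c p.
Proof.
move=> xb; apply: le_trans (Eterm_le p i j xb) _.
by move: xb; rewrite in_itv /= => /andP[x0 xb]; exact: exp_coeff_nd.
Qed.

Let tail0 : tail N @[N --> \oo] --> 0.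
Proof.
rewrite -(subrr C); apply: cvgB; first exact: cvg_cst.
exact: is_cvg_series_exp_coeff.
Qed.

Let tail_small (e : R) : 0 < e -> exists N, forall m, (N <= m)%N -> tail m < e.
Proof.
move=> e0; move/cvgrPdist_lt : tail0 => /(_ e e0)[N _ HN].
exists N => m /HN; rewrite sub0r normrN; apply: le_lt_trans; exact: ler_norm.
Qed.

Let S N x : 'M[K]_n := \sum_(p < N) Eterm A p x.

Let S_tail N x i j : x \in `[0, b] -> modulus (Eseries A x i j - S N x i j) <= tail N.
Proof.
move=> xb; have [l cl Hl] := @cvg_series_dominated R k
  (fun p => Eterm A p x i j) c (fun p => E_lec p i j xb) (is_cvg_series_exp_coeff _).
have -> : Eseries A x i j = l.
  by rewrite mxE; apply: cvg_lim cl; exact: norm_hausdorff.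
by have := Hl N; rewrite /series /= big_mkord /S summxE.
Qed.

Let S_primitive N : primitive b (S N.+1) (fun x => A x *m S N x) /\ S N.+1 0 = 1%:M.
Proof.
elim: N => [|N [IH IH0]].
  split; last by rewrite /S big_ord1.
  apply: eq_primitive (primitive_cst b 1%:M) => x _; rewrite /S.
    by rewrite big_ord1.
  by rewrite big_ord0 mulmx0.
have [pE E0] := Eterm_primitive N.
split; last first.
  rewrite /S big_ord_recr /= -/(S N.+1 0) IH0.
  by rewrite -[mx_integral _ _]/(Eterm A N.+1 0) E0 addr0.
apply: eq_primitive (primitiveD IH pE) => x _.
  by rewrite /S [RHS]big_ord_recr.
by rewrite -mulmxDr /S [in RHS]big_ord_recr.
Qed.

Let tail_ge0 N : 0 <= tail N.
Proof.
rewrite subr_ge0; apply: nondecreasing_cvgn_le; last exact: is_cvg_series_exp_coeff.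
apply/nondecreasing_seqP => p; rewrite /series /= big_nat_recr//= lerDl.
by rewrite /c /exp_coeff /= divr_ge0// exprn_ge0// mulr_ge0// ltW.
Qed.

Let S_le N x i j : x \in `[0, b] -> modulus (S N x i j) <= C.
Proof.
move=> xb; rewrite /S summxE; apply: le_trans (modulus_sum _ _ _) _.
apply: (@le_trans _ _ (series c N)); last by rewrite -subr_ge0; exact: tail_ge0.
by rewrite /series /= big_mkord; apply: ler_sum => p _; exact: E_lec.
Qed.

Let C_ge0 : 0 <= C.
Proof. by have := tail_ge0 0; rewrite /tail /series /= big_geq// subr0. Qed.

(** All partial sums have the Lipschitz constant L C, hence so does their
    limit. *)
Let Eseries_bi : mx_bounded_integrable b (Eseries A).
Proof.
move=> i j; apply: absolutely_continuous_bounded_integrable => //.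
apply: (@lipschitz_absolutely_continuous _ _ _ (L * C)) => s t s0 st tb.
apply/ler_addgt0Pr => e e0.
have [N HN] := tail_small (divr_gt0 e0 (ltr0Sn R 1)).
have sb : s \in `[0, b] by rewrite in_itv /= s0 (le_trans st).
have tb' : t \in `[0, b] by rewrite in_itv /= tb (le_trans s0).
have := primitive_lipschitz (i := i) (j := j) (mulr_ge0 L_ge0 C_ge0)
  (S_primitive N).1 (fun x xb => modulus_A_mul _ xb (fun l => S_le N l j xb)) s0 st tb.
have := S_tail N.+1 i j sb; have := S_tail N.+1 i j tb'.
have := HN N.+1 (leqnSn N).
move: (Eseries A t i j) (Eseries A s i j) (S N.+1 t i j) (S N.+1 s i j) => Et Es St Ss.
move: (tail _) => tl H1 H2 H3 H4.
have -> : Et - Es = (Et - St) - (Es - Ss) + (St - Ss).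
  by rewrite addrAC [- (Es - Ss)]opprB subrKA subrKA.
apply: le_trans (modulusD _ _) _; rewrite addrC; apply: lerD => //.
by apply: le_trans (modulusB _ _) _; lra.
Qed.

(** The integral equation E = 1 + int A E holds because the partial sums satisfy
    S_(N+1) = 1 + int A S_N and converge uniformly. *)
Lemma Eseries_primitive :
  primitive b (Eseries A) (fun x => A x *m Eseries A x) /\ Eseries A 0 = 1%:M.
Proof.
have [pI I0] := primitive_integral b_gt0 (mx_bounded_integrableM A_bi Eseries_bi).
pose W x := 1%:M + mx_integral x (fun t => A t *m Eseries A t).
have pW : primitive b W (fun x => A x *m Eseries A x).
  by apply: eq_primitive (primitiveD (primitive_cst b 1%:M) pI) => // x _; rewrite add0r.
have W0 : W 0 = 1%:M by rewrite /W I0 addr0.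
suff WE x : x \in `[0, b] -> W x = Eseries A x.
  by split; [apply: eq_primitive pW|rewrite -WE// in_itv /= lexx ltW].
move=> xb; move: (xb); rewrite in_itv /= => /andP[x0 xb'].
apply/matrixP => i j; apply/eqP; rewrite -subr_eq0; apply/eqP; apply: modulus_le0.
apply/ler_addgt0Pr => e e0; rewrite add0r.
have Lb0 : 0 < L * b + 1 by rewrite ltr_wpDl// mulr_ge0// ltW.
have [N HN] := tail_small (divr_gt0 e0 Lb0).
have [pS S0] := S_primitive N.
have := primitive_lipschitz (i := i) (j := j) (mulr_ge0 L_ge0 (tail_ge0 N))
  (primitiveB pW pS) _ (lexx 0) x0 xb'.
have mB (P Q : 'M[K]_n) : (P - Q) i j = P i j - Q i j by rewrite !mxE.
rewrite /= !mB W0 S0 subrr !subr0 => WS.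
have {}WS : modulus (W x i j - S N.+1 x i j) <= L * tail N * x.
  apply: WS => y yb; rewrite -mulmxBr; apply: modulus_A_mul => // l.
  have -> : (Eseries A y - S N y) l j = Eseries A y l j - S N y l j.
    by rewrite mxE [(- S N y) l j]mxE.
  exact: S_tail.
have ES := S_tail N.+1 i j xb.
have -> : W x i j - Eseries A x i j =
    (W x i j - S N.+1 x i j) - (Eseries A x i j - S N.+1 x i j).
  by rewrite opprB subrKA.
apply: le_trans (modulusB _ _) _.
have tN := HN N (leqnn N); have tN1 := HN N.+1 (leqnSn N).
have xle : L * tail N * x <= L * b * (e / (L * b + 1)).
  rewrite -mulrA -[leRHS]mulrA ler_wpM2l// mulrC.
  by apply: ler_pM => //; exact: ltW.
have -> : e = L * b * (e / (L * b + 1)) + e / (L * b + 1).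
  by rewrite -[X in _ + X]mul1r -mulrDl mulrC divfK// gt_eqF.
apply: lerD; first exact: le_trans xle.
exact: le_trans ES (ltW tN1).
Qed.

End Eseries.

(** * The series F and variation of constants *)

Section Fseries.
Variables (R : realType) (k : scalar_kind) (b : R).
Hypothesis b_gt0 : 0 < b.
Local Notation K := (scalar_field R k).
Variable n : nat.
Implicit Types A X : R -> 'M[K]_n.

(** Transposition exchanges the two recursions since it reverses products. *)
Lemma Fterm_trmx X p x : Fterm X p x = (Eterm (fun t => (X t)^T) p x)^T.
Proof.
elim: p x => [|p IH] x; first by rewrite /= trmx1.
apply/matrixP => i j; rewrite !mxE; congr scalar_integral; apply/funext => t.
have -> : (X t)^T *m Eterm (fun t => (X t)^T) p t = (Fterm X p t *m X t)^T.
  by rewrite trmx_mul IH trmxK.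
by rewrite [RHS]mxE.
Qed.

Lemma Fseries_trmx X x : Fseries X x = (Eseries (fun t => (X t)^T) x)^T.
Proof.
apply/matrixP => i j; rewrite !mxE; congr (limn (series _)).
by apply/funext => p; rewrite Fterm_trmx mxE.
Qed.

Lemma Fseries_primitive X : mx_bounded_integrable b X ->
  primitive b (Fseries X) (fun x => Fseries X x *m X x) /\ Fseries X 0 = 1%:M.
Proof.
move=> /mx_bounded_integrableT/(Eseries_primitive b_gt0)[pE E0].
split; last by rewrite Fseries_trmx E0 trmx1.
apply: eq_primitive (primitiveT pE) => x _; first by rewrite Fseries_trmx.
by rewrite trmx_mul trmxK Fseries_trmx.
Qed.

(** The derivative of the product is - F A E + F A E = 0. *)
Lemma Fseries_mul_Eseries A x : mx_bounded_integrable b A -> x \in `[0, b] ->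
  Fseries (fun t => - A t) x *m Eseries A x = 1%:M.
Proof.
move=> A_bi.
have [pE E0] := Eseries_primitive b_gt0 A_bi.
have [pF F0] := Fseries_primitive (mx_bounded_integrableN A_bi).
have pFE : primitive b
    (fun y => Fseries (fun t => - A t) y *m Eseries A y) (fun=> 0).
  apply: eq_primitive (primitiveM pF pE) => // y _.
  by rewrite mulmxN mulNmx mulmxA addNr.
apply: (primitive_unique pFE (primitive_cst b 1%:M)).
by rewrite E0 F0 mulmx1.
Qed.

Lemma general_solution_primitive A (F : R -> 'cV[K]_n) (C : 'cV[K]_n) :
  mx_bounded_integrable b A -> mx_bounded_integrable b F ->
  primitive b (general_solution A F C)
    (fun x => A x *m general_solution A F C x + F x).
Proof.
move=> A_bi F_bi.
have [pE E0] := Eseries_primitive b_gt0 A_bi.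
have [pF F0] := Fseries_primitive (mx_bounded_integrableN A_bi).
have [pI I0] := primitive_integral b_gt0
  (mx_bounded_integrableM (primitive_bounded_integrable pF) F_bi).
apply: eq_primitive (primitiveM pE (primitiveD (primitive_cst b C) pI)) => x xb.
  by rewrite /general_solution mulmxDr.
rewrite add0r mulmxA (mulmx1C (Fseries_mul_Eseries A_bi xb)) mul1mx.
by rewrite /general_solution -mulmxDr mulmxA.
Qed.

(** Multiplying the equation by F[-A] turns it into (F[-A] U)' = F[-A] F, which
    is solved by integration. *)
Lemma primitive_general_solution A (F U : R -> 'cV[K]_n) :
  mx_bounded_integrable b A -> mx_bounded_integrable b F ->
  primitive b U (fun x => A x *m U x + F x) ->
  forall x, x \in `[0, b] -> U x = general_solution A F (U 0) x.
Proof.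
move=> A_bi F_bi pU x xb.
have [pF F0] := Fseries_primitive (mx_bounded_integrableN A_bi).
have [pI I0] := primitive_integral b_gt0
  (mx_bounded_integrableM (primitive_bounded_integrable pF) F_bi).
have pFU : primitive b (fun y => Fseries (fun t => - A t) y *m U y)
    (fun y => Fseries (fun t => - A t) y *m F y).
  apply: eq_primitive (primitiveM pF pU) => // y _.
  by rewrite mulmxDr addrA mulmxN mulNmx mulmxA addNr add0r.
have FUE := primitive_unique pFU (W := fun y => U 0 + mx_integral y
  (fun s => Fseries (fun t => - A t) s *m F s)) _ _ xb.
rewrite /general_solution -mulmxDr -FUE; last first.
- by rewrite F0 I0 mul1mx addr0.
- by apply: eq_primitive (primitiveD (primitive_cst b (U 0)) pI) => // y _; rewrite add0r.
by rewrite mulmxA (mulmx1C (Fseries_mul_Eseries A_bi xb)) mul1mx.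
Qed.

Lemma system_solution_primitive A (F U : R -> 'cV[K]_n) :
  system_solution b A F U <-> primitive b U (fun x => A x *m U x + F x).
Proof.
split=> -[acU dU]; split.
- by move=> i j; rewrite (ord1 j).
- by apply: filterS dU => x dx xb i j; rewrite (ord1 j); exact: dx.
- by move=> i; exact: acU.
- by apply: filterS dU => x dx xb i; exact: dx.
Qed.

End Fseries.

(** * The scalar equation *)

Section scalar_equation.
Variables (R : realType) (k : scalar_kind) (b : R).
Hypothesis b_gt0 : 0 < b.
Local Notation K := (scalar_field R k).

Lemma companion_bounded_integrable (n : nat) (a : 'I_n -> R -> K) :
  (forall i, bounded_integrable b (a i)) ->
  mx_bounded_integrable b (companion a).
Proof.
move=> a_bi i j; have [i0|iN0] := eqVneq (i : nat) 0%N.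
  rewrite [X in bounded_integrable _ X](_ : _ = fun x => - a j x).
    exact: bounded_integrableN.
  by apply/funext => x; rewrite mxE i0.
rewrite [X in bounded_integrable _ X](_ : _ = fun=> (i == j.+1 :> nat)%:R).
  exact: bounded_integrable_cst.
by apply/funext => x; rewrite mxE (negbTE iN0).
Qed.

Lemma forcing_bounded_integrable (n : nat) (f : R -> K) :
  bounded_integrable b f -> mx_bounded_integrable b (@forcing R k n f).
Proof.
move=> f_bi i j; have [i0|iN0] := eqVneq (i : nat) 0%N.
  rewrite [X in bounded_integrable _ X](_ : _ = f)//.
  by apply/funext => x; rewrite mxE i0.
rewrite [X in bounded_integrable _ X](_ : _ = fun=> 0).
  exact: bounded_integrable_cst.
by apply/funext => x; rewrite mxE (negbTE iN0).
Qed.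

Lemma companion_row0 (m : nat) (a : 'I_m.+1 -> R -> K) (f : R -> K)
    (U : R -> 'cV[K]_m.+1) x :
  (companion a x *m U x + forcing m.+1 f x) ord0 ord0 =
  f x - \sum_j a j x * U x j ord0.
Proof.
rewrite !mxE /= addrC -sumrN; congr (_ + _); apply: eq_bigr => j _.
by rewrite mxE mulNr.
Qed.

Lemma companion_rowS (m : nat) (a : 'I_m.+1 -> R -> K) (f : R -> K)
    (U : R -> 'cV[K]_m.+1) x (i j : 'I_m.+1) : i = j.+1 :> nat ->
  (companion a x *m U x + forcing m.+1 f x) i ord0 = U x j ord0.
Proof.
move=> ij; rewrite !mxE ij /= addr0 (bigD1 j)//= mxE ij /= eqxx mul1r.
rewrite big1 ?addr0// => l lj; rewrite mxE ij /= eqSS.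
by rewrite (_ : (_ == _) = false) ?mul0r//; apply/negbTE; rewrite eq_sym.
Qed.

Lemma nth_derivative_unique p (u v w : R -> K) :
  nth_derivative b p u v -> nth_derivative b p u w ->
  forall x, x \in `[0, b] -> v x = w x.
Proof.
elim: p v w => [|p IH] v w /=.
  by move=> uv uw x xb; rewrite uv// uw.
move=> [v1 [uv1 v1v]] [w1 [uw1 w1w]] x xb.
move: (xb); rewrite in_itv /= => /andP[x0 xb'].
apply: (has_derivative_unique b_gt0 x0 xb' (v1v x xb)).
apply: eq_has_derivative (w1w x xb) => // y y0 yb.
by apply: (IH _ _ uw1 uv1); rewrite in_itv /= y0.
Qed.

(** Near x the derivative v differs from v x by at most e, so the mean value
    inequality bounds the increments of z |-> u z - z v x by e |y - x|. *)
Lemma ae_derivative_everywhere (u v : R -> K) :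
  absolutely_continuous b u -> absolutely_continuous b v ->
  {ae leb R, forall x, x \in `[0, b] -> has_derivative b u x (v x)} ->
  forall x, x \in `[0, b] -> has_derivative b u x (v x).
Proof.
move=> acu acv uv x; rewrite in_itv /= => /andP[x0 xb].
apply/has_derivativeP => e e0.
have [d d0 Hd] := absolutely_continuous_uniform acv e0.
exists d => // y y0 yb yxd.
(* Subtracting the tangent slope leaves a function with small derivative near x. *)
pose w z := u z + of_real k z * - v x.
have acid : absolutely_continuous b (@of_real R k).
  apply: (@lipschitz_absolutely_continuous _ _ _ 1) => s t _ st _.
  by rewrite -of_realB modulus_of_real mul1r ger0_norm ?subr_ge0.
have acw : absolutely_continuous b w.
  apply: absolutely_continuousD => //; apply: absolutely_continuousM => //.
  exact: absolutely_continuous_cst.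
have key s t : 0 <= s -> s <= t -> t <= b ->
    (forall z, s <= z -> z <= t -> `|z - x| < d) ->
    modulus (w t - w s) <= e * t - e * s.
  move=> s0 st tb near_x; apply: (mean_value_ineq (phi := fun z => e * z) s0 st tb acw).
    by move=> z z' _ zz _; rewrite ler_pM2l.
  apply: filterS uv => z Hz sz zt.
  have z0 := le_trans s0 sz; have zb := le_trans zt tb.
  exists (v z + (1 * - v x + of_real k z * 0)), e; split.
  - apply: has_derivativeD; first by apply: Hz; rewrite in_itv /= z0.
    apply: has_derivativeM; first exact: has_derivative_id.
    exact: has_derivative_cst.
  - have := has_derivativeM (has_derivative_cst b (e : scalar_field R RealScalars) z)
      (@has_derivative_id R RealScalars b z).
    by apply: has_derivative_ext => //=; rewrite mul0r add0r mulr1.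
  - by rewrite mul1r mulr0 addr0; apply: ltW; apply: Hd => //; exact: near_x.
have -> : u y - u x - of_real k (y - x) * v x = w y - w x.
  by rewrite /w opprD addrACA of_realB mulrBl !mulrN opprK opprB [- _ + _]addrC.
have [xy|yx] := leP x y.
  rewrite (ger0_norm (_ : 0 <= y - x)) ?subr_ge0// mulrBr; apply: key => // z xz zy.
  rewrite ger0_norm ?subr_ge0//; apply: le_lt_trans yxd.
  by rewrite ger0_norm ?subr_ge0// lerD2r.
rewrite modulusBC distrC (ger0_norm (_ : 0 <= x - y)) ?subr_ge0 ?(ltW yx)// mulrBr.
apply: key => //; first exact: ltW.
move=> z yz zx; apply: le_lt_trans yxd; rewrite distrC [leRHS]distrC.
by rewrite !ger0_norm ?subr_ge0 ?(ltW yx)// lerD2l lerN2.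
Qed.

(** The derivative is bounded, so the function is Lipschitz. *)
Lemma everywhere_derivative_absolutely_continuous (u v : R -> K) :
  absolutely_continuous b v ->
  (forall x, x \in `[0, b] -> has_derivative b u x (v x)) ->
  absolutely_continuous b u.
Proof.
move=> /absolutely_continuous_bounded[M M0 HM] uv.
apply: (@lipschitz_absolutely_continuous _ _ _ M) => s t s0 st tb.
rewrite mulrBr; apply: (mean_value_ineq_everywhere (b := b) (phi := fun z => M * z)) => //.
  by move=> z z' _ zz _; rewrite ler_wpM2l.
move=> x sx xt; have x0 := le_trans s0 sx; have xb := le_trans xt tb.
exists (v x), M; split; [by apply: uv; rewrite in_itv /= x0| |exact: HM].
have := has_derivativeM (has_derivative_cst b (M : scalar_field R RealScalars) x)
  (@has_derivative_id R RealScalars b x).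
by apply: has_derivative_ext => //=; rewrite mul0r add0r mulr1.
Qed.

(** Derivatives are unique on [0, b], so the entries of U are the derivatives of u
    occurring in the scalar equation.  Absolute continuity passes from each entry
    to the next, of which it is the derivative. *)
Lemma system_of_scalar (m : nat) (a : 'I_m.+1 -> R -> K) (f u : R -> K)
    (U : R -> 'cV[K]_m.+1) :
  scalar_solution b a f u -> derivative_vector b u U ->
  system_solution b (companion a) (@forcing R k m.+1 f) U.
Proof.
move=> [d [ud acd dd]] uU.
have UE (i : 'I_m.+1) x : x \in `[0, b] -> U x i ord0 = d (m - i)%N x.
  by apply: (nth_derivative_unique (uU i)); apply: ud; rewrite /= ltnS leq_subr.
have UE' (i : 'I_m.+1) x : 0 <= x -> x <= b -> d (m - i)%N x = U x i ord0.
  by move=> x0 xb; rewrite UE// in_itv /= x0.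
have dU (i j : 'I_m.+1) : i = j.+1 :> nat -> forall x, x \in `[0, b] ->
    has_derivative b (fun y => U y i ord0) x (U x j ord0).
  move=> ij x xb; have := uU j; rewrite /= -(subnSK (_ : (j < m)%N)); last first.
    by rewrite -ij -ltnS.
  move=> [w [uw dw]].
  move: (xb); rewrite in_itv /= => /andP[x0 xb'].
  apply: eq_has_derivative (dw x xb) => // y y0 yb.
  have yb' : y \in `[0, b] by rewrite in_itv /= y0.
  apply: (nth_derivative_unique (w := fun y => U y i ord0) uw _ yb').
  by rewrite -ij; exact: uU.
have acU p : forall i : 'I_m.+1, i = p :> nat ->
    absolutely_continuous b (fun x => U x i ord0).
  elim: p => [|p IH] i ip.
    apply: eq_absolutely_continuous acd => x x0 xb.
    by rewrite -(UE' i)// ip subn0.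
  have pm : (p < m.+1)%N by rewrite ltnW// -ip.
  apply: (everywhere_derivative_absolutely_continuous (IH (Ordinal pm) erefl)).
  exact: dU.
split=> [i|]; first exact: (acU i).
apply: filterS dd => x Hx xb i; move: (xb); rewrite in_itv /= => /andP[x0 xb'].
have [i0|iN0] := eqVneq i ord0.
  rewrite i0 companion_row0; have [v dv vf] := Hx xb.
  have <- : v = f x - \sum_j a j x * U x j ord0.
    rewrite (eq_bigr (fun j : 'I_m.+1 => a j x * d (m - j)%N x)).
      by rewrite -vf addrK.
    by move=> j _; rewrite UE.
  apply: eq_has_derivative dv => // y y0 yb.
  by rewrite -(UE' ord0)// subn0.
have im : (i.-1 < m.+1)%N by rewrite (leq_ltn_trans (leq_pred i)).
have ij : i = (Ordinal im).+1 :> nat by rewrite /= prednK// lt0n.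
by rewrite (companion_rowS _ _ _ _ ij); exact: dU.
Qed.

(** The function u is the last entry of U, and its p-th derivative is the entry of
    index n - 1 - p. *)
Lemma scalar_of_system (m : nat) (a : 'I_m.+1 -> R -> K) (f : R -> K)
    (U : R -> 'cV[K]_m.+1) :
  system_solution b (companion a) (@forcing R k m.+1 f) U ->
  exists2 u : R -> K, scalar_solution b a f u & derivative_vector b u U.
Proof.
move=> [acU dU].
pose d p x := U x (inord (m - p)) ord0.
have dU' (i j : 'I_m.+1) : i = j.+1 :> nat -> forall x, x \in `[0, b] ->
    has_derivative b (fun y => U y i ord0) x (U x j ord0).
  move=> ij; apply: ae_derivative_everywhere => //.
  by apply: filterS dU => x Hx xb; rewrite -(companion_rowS a f _ _ ij); exact: Hx.
have ud p : (p < m.+1)%N -> nth_derivative b p (d 0%N) (d p).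
  elim: p => [//|p IH] pm /=; exists (d p); split; first exact: IH (ltnW pm).
  by apply: dU'; rewrite !inordK ?ltnS ?leq_subr// subnSK.
have dE (i : 'I_m.+1) x : d (m - i)%N x = U x i ord0.
  by rewrite /d subKn ?inord_val// -ltnS.
exists (d 0%N); last first.
  move=> i; rewrite (_ : (fun x => U x i ord0) = d (m - i)%N).
    by apply: ud; rewrite ltnS leq_subr.
  by apply/funext => x; rewrite dE.
have dmE : d m = fun x => U x ord0 ord0.
  by apply/funext => x; rewrite -(dE ord0) subn0.
exists d; split => //=; first by rewrite dmE; exact: acU.
apply: filterS dU => x Hx xb; exists (f x - \sum_j a j x * U x j ord0).
  by rewrite dmE -companion_row0; exact: Hx.
by under [X in _ + X]eq_bigr do rewrite dE; rewrite subrK.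
Qed.

End scalar_equation.

(** * The general solution *)

Theorem theorem2p1 (R : realType) (k : scalar_kind) (n : nat) (b : R)
    (a : 'I_n -> R -> scalar_field R k) (f : R -> scalar_field R k)
    (n_ge1 : (1 <= n)%N) (b_gt0 : 0 < b)
    (a_bi : forall i, bounded_integrable b (a i))
    (f_bi : bounded_integrable b f) :
  let A := companion a in
  let F := @forcing R k n f in
  [/\ forall U : R -> 'cV[scalar_field R k]_n,
        system_solution b A F U <->
        exists2 u : R -> scalar_field R k,
          scalar_solution b a f u & derivative_vector b u U,
      forall C : 'cV[scalar_field R k]_n,
        system_solution b A F (general_solution A F C) &
      forall U : R -> 'cV[scalar_field R k]_n, system_solution b A F U ->
        exists C : 'cV[scalar_field R k]_n,
          forall x, x \in `[0, b] -> U x = general_solution A F C x].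
Proof.
move=> A F.
have A_bi : mx_bounded_integrable b A by exact: companion_bounded_integrable.
have F_bi : mx_bounded_integrable b F by exact: forcing_bounded_integrable.
split=> [U|C|U /system_solution_primitive pU].
- case: n n_ge1 a a_bi @A @F A_bi F_bi U => [//|m] _ a a_bi A F A_bi F_bi U.
  split=> [|[u]]; first exact: scalar_of_system.
  exact: system_of_scalar.
- by apply/system_solution_primitive; exact: general_solution_primitive.
- by exists (U 0); exact: primitive_general_solution.
Qed.
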